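(* In the Fraunhofer regime, let $\widetilde{\boldsymbol\alpha}(\mathbf y;k)$ be the $2\times2$ reconstruction $$\widetilde{\boldsymbol\alpha}=\widetilde{\boldsymbol\alpha}(\mathbf y;k)=\frac{(4\pi L)^4}{\operatorname{mes}\mathcal A}\,\mathbf U_\parallel^*\,\mathcal I_{KM}(\mathbf y;k)\,\mathbf U_s$$ computed from the full array data of $N$ dipoles $\mathbf y_1,\dots,\mathbf y_N$ with polarizability tensors $\boldsymbol\alpha_1,\dots,\boldsymbol\alpha_N$, and let $\widetilde{\boldsymbol\alpha}_i=\mathbf U_\parallel^*\boldsymbol\alpha_i\mathbf U_s$. Then, with $\|\cdot\|_F$ the Frobenius norm: (i) if the imaging point coincides with a dipole, $\mathbf y=\mathbf y_i$, then $$\|\widetilde{\boldsymbol\alpha}-\widetilde{\boldsymbol\alpha}_i\|_F=\mathcal O\left(\frac{L}{a\,k\min_{j\ne i}|\mathbf y_{i,\parallel}-\mathbf y_{j,\parallel}|}\right)+\mathcal O\left(\frac aL\right)+\mathcal O\left(\frac{a^2\Theta_a}{L^2}\right)+\mathcal O(\Theta_b);$$ (ii) if the imaging point $\mathbf y$ does not coincide with a dipole in cross-range, i.e. $\mathbf y_\parallel\neq\mathbf y_{j,\parallel}$ for all $j=1,\dots,N$, then $$\|\widetilde{\boldsymbol\alpha}\|_F=\mathcal O\left(\frac{L}{a\,k\min_{j=1,\dots,N}|\mathbf y_\parallel-\mathbf y_{j,\parallel}|}\right)+\mathcal O\left(\frac{a^2\Theta_a}{L^2}\right)+\mathcal O(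\Theta_b).$$
   Context: Points of $\mathbb R^3$ are written $\mathbf x=(\mathbf x_\parallel,x_3)$. For $k>0$, $\mathbf r=\mathbf x-\mathbf y\neq 0$, $r=|\mathbf r|$, the dyadic Green function is $$\mathbf G(\mathbf x,\mathbf y;k)=\frac{e^{\imath kr}}{4\pi r}\left[(1+m(kr))\mathbf I-(1+3m(kr))\frac{\mathbf r\mathbf r^\top}{r^2}\right],\quad m(kr)=\frac{\imath kr-1}{(kr)^2}.$$ The array is $\mathcal A=a\widetilde{\mathcal A}$, contained in the plane $x_3=0$ (identified with $\mathbb R^2$), where the shape $\widetilde{\mathcal A}$ is a fixed bounded planar domain with piecewise smooth boundary (e.g. a unit square centered at the origin); $\operatorname{mes}\mathcal A$, its area, is of order $a^2$. Dipoles $\mathbf y_j$ and imaging points $\mathbf y=(\mathbf y_\parallel,L+\eta)$ lie in an imaging window where $|\mathbf y_\parallel|=\mathcal O(b)$, $|\eta|=\mathcal O(h)$. The source $\mathbf x_s$ satisfies $|\mathbf x_s-\mathbf y_0|=L$ where $\mathbf y_0=(0,0,L)$. The $\boldsymbol\alpha_j$ are $3\times3$ complex symmetric matrices with $\|\boldsymbol\alpha_j\|=\mathcal O(1)$; $N$ is fixed. $\mathbf U_\parallel=[\mathbf e_1,\mathbf e_2]$ and $\mathbf U_s$ is a real $3\times 2$ matrix whose columns form an orthonormal basis of $(\mathbf y_0-\mathbf x_s)^\perp$. Full data and imaging function: $\boldsymbol\Pi(\mathbf x_r,\mathbf x_s;k)=\sum_{n=1}^N\mathbf G(\mathbf x_r,\mathbf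 y_n;k)\boldsymbol\alpha_n\mathbf G(\mathbf y_n,\mathbf x_s;k)$ and $$\mathcal I_{KM}(\mathbf y;k)=\int_{\mathcal A}d\mathbf x_{r,\parallel}\,\overline{\mathbf G(\mathbf x_r,\mathbf y;k)}\,\boldsymbol\Pi(\mathbf x_r,\mathbf x_s;k)\,\overline{\mathbf G(\mathbf x_s,\mathbf y;k)}.$$ Fraunhofer regime: with $\Theta_a=ka^2/L$, $\Theta_b=kb^2/L$, $\Theta_h=kh^2/L$, one assumes $kL\gg1$, $a\ll L$, $b\ll L$, $h\ll L$ (equivalently $\Theta_a,\Theta_b,\Theta_h\ll kL$), $\Theta_b\ll1$, $1\ll\Theta_a\ll L^2/a^2$ (so $b\ll a$), and $kh=\mathcal O(1)$. Here $\ll$ means that the ratio tends to $0$; $\mathcal O$ constants are independent of $k,L,a,b,h$ and of the points considered. A bound with a vanishing minimum in the denominator is vacuous. *)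

(* Defs.v *)
From mathcomp Require Export all_boot all_order all_algebra.
From mathcomp Require Export all_classical all_reals all_analysis.
From mathcomp Require Export complex.

Set Implicit Arguments.
Unset Strict Implicit.
Unset Printing Implicit Defensive.

Export Order.TTheory GRing.Theory Num.Theory.
Export numFieldNormedType.Exports.

Local Open Scope classical_set_scope.
Local Open Scope complex_scope.
Local Open Scope ring_scope.

Definition enorm (R : realType) (n : nat) (v : 'cV[R]_n) : R :=
  Num.sqrt (\sum_(i < n) v i 0 ^+ 2).

Definition frob (R : realType) (m n : nat) (A : 'M[R[i]]_(m, n)) : R :=
  Num.sqrt (\sum_(i < m) \sum_(j < n) Normc.normc (A i j) ^+ 2).

Definition cplx_mx (R : realType) (m n : nat) (A : 'M[R]_(m, n)) :
  'M[R[i]]_(m, n) := map_mx (fun x => x%:C) A.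

Definition conj_mx (R : realType) (m n : nat) (A : 'M[R[i]]_(m, n)) :
  'M[R[i]]_(m, n) := map_mx (fun z => z^*) A.

Definition adj_mx (R : realType) (m n : nat) (A : 'M[R[i]]_(m, n)) :
  'M[R[i]]_(n, m) := (conj_mx A)^T.

(* x_par = (x_1, x_2), splitting 'cV_3 as 'cV_(2 + 1). *)
Definition cross_range (R : realType) (x : 'cV[R]_3) : 'cV[R]_2 :=
  @usubmx R 2 1 1 x.

Definition range3 (R : realType) (x : 'cV[R]_3) : R := x ord_max 0.

Definition in_plane (R : realType) (p : R * R) : 'cV[R]_3 :=
  \col_(i < 3) [:: p.1; p.2; 0]`_i.

(* The reference point y_0 = (0, 0, L). *)
Definition ref_point (R : realType) (L : R) : 'cV[R]_3 :=
  L *: delta_mx ord_max 0.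

(* e^{i t} *)
Definition expi (R : realType) (t : R) : R[i] := cos t +i* sin t.

Definition mfun_green (R : realType) (s : R) : R[i] :=
  ('i%C * s%:C - 1) / s%:C ^+ 2.

Definition green (R : realType) (k : R) (x y : 'cV[R]_3) : 'M[R[i]]_3 :=
  let rv := x - y in
  let r := enorm rv in
  let m := mfun_green (k * r) in
  (expi (k * r) / (4 * pi * r)%:C) *:
    ((1 + m) *: 1%:M - (1 + 3 * m) *: cplx_mx ((r ^+ 2)^-1 *: (rv *m rv^T))).

Definition area_measure (R : realType) :
    {measure set (measurableTypeR R * measurableTypeR R)%type -> \bar R} :=
  (@lebesgue_measure R \x @lebesgue_measure R)%E.

Definition mes (R : realType) (D : set (R * R)) : R :=
  fine (area_measure R D).

Definition mx_integral (R : realType) (m n : nat) (D : set (R * R))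
    (f : R * R -> 'M[R[i]]_(m, n)) : 'M[R[i]]_(m, n) :=
  \matrix_(i < m, j < n)
    ((\int[area_measure R]_(p in D) complex.Re (f p i j)) +i*
     (\int[area_measure R]_(p in D) complex.Im (f p i j))).

Definition scaled_array (R : realType) (a : R) (shape : set (R * R)) :
  set (R * R) := [set (a * p.1, a * p.2) | p in shape].

Definition array_data (R : realType) (N : nat) (k : R)
    (ys : 'I_N -> 'cV[R]_3) (alphas : 'I_N -> 'M[R[i]]_3)
    (xr xs : 'cV[R]_3) : 'M[R[i]]_3 :=
  \sum_(n < N) green k xr (ys n) *m alphas n *m green k (ys n) xs.

Definition I_KM (R : realType) (N : nat) (A : set (R * R)) (k : R)
    (ys : 'I_N -> 'cV[R]_3) (alphas : 'I_N -> 'M[R[i]]_3)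
    (xs y : 'cV[R]_3) : 'M[R[i]]_3 :=
  mx_integral A (fun p =>
    conj_mx (green k (in_plane p) y)
      *m array_data k ys alphas (in_plane p) xs
      *m conj_mx (green k xs y)).

Definition U_par (R : realType) : 'M[R]_(3, 2) :=
  \matrix_(i < 3, j < 2) (i == j :> nat)%:R.

Definition alpha_rec (R : realType) (N : nat) (A : set (R * R)) (k L : R)
    (ys : 'I_N -> 'cV[R]_3) (alphas : 'I_N -> 'M[R[i]]_3)
    (xs : 'cV[R]_3) (Us : 'M[R]_(3, 2)) (y : 'cV[R]_3) : 'M[R[i]]_2 :=
  ((4 * pi * L) ^+ 4 / mes A)%:C *:
    (adj_mx (cplx_mx (U_par R)) *m I_KM A k ys alphas xs y *m cplx_mx Us).

Definition alpha_proj (R : realType) (Us : 'M[R]_(3, 2))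
    (alpha : 'M[R[i]]_3) : 'M[R[i]]_2 :=
  adj_mx (cplx_mx (U_par R)) *m alpha *m cplx_mx Us.

Definition orthonormal_basis_of_perp (R : realType) (d : 'cV[R]_3)
    (U : 'M[R]_(3, 2)) : Prop :=
  U^T *m U = 1%:M /\
  (forall v : 'cV[R]_3, d^T *m v = 0 <-> exists c : 'cV[R]_2, v = U *m c).

(* y = (y_par, L + eta) with |y_par| <= cpar b and |eta| <= ceta h. *)
Definition in_window (R : realType) (cpar ceta L b h : R)
    (y : 'cV[R]_3) : Prop :=
  enorm (cross_range y) <= cpar * b /\ `|range3 y - L| <= ceta * h.

Definition C1 (R : realType) (g : R -> R) : Prop :=
  (forall s, derivable g s 1) /\ continuous (derive1 g).

(* A regular C^1 arc. Its parametrization is taken to be C^1 on the whole line,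
   which loses no generality: a C^1 function on [0, 1] (with one-sided
   derivatives at the end points) extends to a C^1 function on R. *)
Definition smooth_arc (R : realType) (G : set (R * R)) : Prop :=
  exists g1 g2 : R -> R,
    [/\ C1 g1, C1 g2,
        (forall s, 0 <= s <= 1 -> (derive1 g1 s, derive1 g2 s) <> (0, 0)) &
        G = [set (g1 s, g2 s) | s in `[0, 1] ] ].

Definition piecewise_smooth_boundary (R : realType) (D : set (R * R)) : Prop :=
  exists (n : nat) (G : 'I_n -> set (R * R)),
    (forall i, smooth_arc (G i)) /\
    closure D `\` interior D = \bigcup_(i in [set: 'I_n]) G i.

Definition planar_shape (R : realType) (D : set (R * R)) : Prop :=
  [/\ D !=set0, open D, connected D, bounded_set D &
      piecewise_smooth_boundary D].

Definition Theta (R : realType) (k L d : R) : R := k * d ^+ 2 / L.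

(* u << v along F *)
Definition much_less (R : realType) (T : Type) (F : set_system T)
    (u v : T -> R) : Prop :=
  u t / v t @[t --> F] --> (0 : R).

(* The lengths and the wavenumber are functions of the index along which the
   limits are taken; M is the constant of kh = O(1). *)
Record fraunhofer (R : realType) (T : Type) (F : set_system T)
    (k L a b h : T -> R) (M : R) : Prop := Fraunhofer {
  fraunhofer_pos : forall t, [/\ 0 < k t, 0 < L t, 0 < a t, 0 < b t & 0 < h t];
  fraunhofer_kL : much_less F (fun=> 1) (fun t => k t * L t);
  fraunhofer_a : much_less F a L;
  fraunhofer_b : much_less F b L;
  fraunhofer_h : much_less F h L;
  fraunhofer_Theta_b : much_less F (fun t => Theta (k t) (L t) (b t)) (fun=> 1);
  fraunhofer_Theta_a : much_less F (fun=> 1) (fun t => Theta (k t) (L t) (a t));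
  fraunhofer_Theta_a_up :
    much_less F (fun t => Theta (k t) (L t) (a t))
                (fun t => L t ^+ 2 / a t ^+ 2);
  fraunhofer_kh : \forall t \near F, k t * h t <= M
}.

(* min over the j satisfying P of the cross-range distance from y to y_j;
   it is +oo when no j satisfies P. *)
Definition min_cross_dist (R : realType) (N : nat) (ys : 'I_N -> 'cV[R]_3)
    (P : pred 'I_N) (y : 'cV[R]_3) : \bar R :=
  \big[Order.min/+oo%E]_(j < N | P j)
    (enorm (cross_range y - cross_range (ys j)))%:E.

(* L / (a k d). Extended-real inversion sends 0 to +oo and +oo to 0, so a
   vanishing minimum d makes the bound vacuous and an empty one contributes
   nothing. *)
Definition cross_term (R : realType) (k L a : R) (d : \bar R) : \bar R :=
  (L%:E / ((a * k)%:E * d))%E.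

(* Main.v *)
From HB Require Import structures.
Require Import Defs.
From mathcomp Require Import measurable_realfun ring lra.

Set Implicit Arguments.
Unset Strict Implicit.
Unset Printing Implicit Defensive.

Local Open Scope classical_set_scope.
Local Open Scope ring_scope.

(* Write 4 pi L G = e^{ikr} K. On the aperture K(x, y) = P + O(a/L), with P the
   projection orthogonal to the axis (or to y_0 - x_s for the source leg), so the
   n-th dipole contributes the average over the array of e^{i phi_n} times
   P alpha_n P_s, up to O(a/L). If y = y_n the phase phi_n vanishes identically.
   Otherwise phi_n is linear in x_par with slope k |y_par - y_n,par| / L, up to
   O(a^2 Theta_a / L^2) + O(Theta_b). A linear phase changes sign under
   translation by half a period, so its integral is at most the area of the
   symmetric difference of the array with its translate, which lies in a thin
   neighbourhood of the boundary; that neighbourhood has small area because each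
   boundary arc is covered by O(1/s) balls of radius s. In (ii) the term O(a/L)
   is absorbed since (a^2 k b / L^2)^2 = (a^2 Theta_a / L^2) Theta_b <= 1. *)

(** * Plane measure *)

(** The constants must not depend on the wavenumber or the lengths. The limits are therefore used
    only once, to reach the finitely many inequalities of [regime], and every estimate is proved at
    fixed parameters. There Theta_a >= 1 gives (k L)^-1 <= (a/L)^2 and, with k h <= M, also h <= M
    (a/L) a: near-field terms and the depth of the window then cost no more than O(a/L) in the
    amplitude. The phase carries the large factor k, so it has to be expanded further, down to the
    order of a^2 Theta_a / L^2 and Theta_b; this is done with exact differences of squares instead
    of Taylor remainders. Translation by half a period takes the place of integration by parts and
    asks of the boundary only a count of covering balls at each scale. The projections disappear at
    the end because [U_par] is orthogonal to the axis and [Us] to y_0 - x_s. *)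

Definition plane (R : realType) := (measurableTypeR R * measurableTypeR R)%type.

(** Balls of the product are taken for the sup distance, hence are squares: they are measurable
    rectangles whose area is read off their sides. *)
Lemma ball_prodE (R : realType) (z : R * R) (e : R) :
  ball z e = ball z.1 e `*` ball z.2 e.
Proof. by []. Qed.

Lemma measurable_plane_ball (R : realType) (z : R * R) (e : R) :
  measurable (ball z e : set (plane R)).
Proof. by rewrite ball_prodE; apply: measurableX; exact: measurable_ball. Qed.

(** The plane carries the product sigma-algebra. An open set belongs to it as the countable union of
    the squares with rational centre and radius that it contains. *)
Lemma open_plane_measurable (R : realType) (U : set (R * R)) :
  open U -> measurable (U : set (plane R)).
Proof.
move=> oU.
have -> : U = \bigcup_(r : rat) \bigcup_(s : rat) \bigcup_(e : rat)
    (if `[< ball (ratr r : R, ratr s : R) (ratr e) `<=` U >]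
     then ball (ratr r : R, ratr s : R) (ratr e) else set0).
  apply/seteqP; split=> [p Up|p [r _ [s _ [e _]]]]; last first.
    by case: asboolP => // sub /sub.
  move: oU; rewrite openE => /(_ _ Up) /nbhs_ballP[d /= d0 dU].
  (* The centre is taken within d / 4 of p. A radius above d / 4 makes the square contain p, and a
     radius below d / 2 keeps it within 3 d / 4 of p. *)
  have d4 : 0 < d / 4 by rewrite divr_gt0.
  have [e /andP[e1 e2]] : exists q : rat, d / 4 < ratr q < d / 2.
    have /rat_in_itvoo[q] : d / 4 < d / 2 by lra.
    by rewrite in_itv /= => ?; exists q.
  have rapprox (x : R) : exists q : rat, `|ratr q - x| < d / 4.
    have /rat_in_itvoo[q] : x < x + d / 4 by lra.
    rewrite in_itv /= => /andP[q1 q2]; exists q.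
    by rewrite ger0_norm ?subr_ge0 1?ltW// ltrBlDl.
  have [r hr] := rapprox p.1; have [s hs] := rapprox p.2.
  exists r => //; exists s => //; exists e => //.
  case: asboolP => [_|]; last first.
    case=> q [/= q1 q2]; apply: dU; split; rewrite /ball /= in q1 q2 *.
      rewrite -(subrKA (ratr r)) (le_lt_trans (ler_normD _ _))//.
      by move: hr; rewrite distrC => hr; lra.
    rewrite -(subrKA (ratr s)) (le_lt_trans (ler_normD _ _))//.
    by move: hs; rewrite distrC => hs; lra.
  by split; rewrite /ball /=; [move: hr|move: hs] => /lt_trans; apply.
apply: bigcupT_measurable_rat => r; apply: bigcupT_measurable_rat => s.
apply: bigcupT_measurable_rat => e.
by case: asboolP => _; [exact: measurable_plane_ball|exact: measurable0].
Qed.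

Lemma area_setX (R : realType) (A B : set (measurableTypeR R)) :
  measurable A -> measurable B ->
  area_measure R (A `*` B) = (lebesgue_measure A * lebesgue_measure B)%E.
Proof.
move=> mA mB.
exact: (@product_measure1E _ _ _ _ R lebesgue_measure lebesgue_measure A B mA mB).
Qed.

Lemma area_ball (R : realType) (z : R * R) (e : R) : 0 <= e ->
  area_measure R (ball z e) = ((2 * e) ^+ 2)%:E.
Proof.
move=> e0; rewrite ball_prodE area_setX; [|exact: measurable_ball..].
by rewrite !lebesgue_measure_ball// -EFinM; congr _%:E; ring.
Qed.

(** The image of Lebesgue measure under a translation has the right value on half-open intervals,
    which determine the measure. In the plane, rectangles play the same role. *)
Lemma lebesgue_measure_translate (R : realType) (c : R) (X : set R) :
  measurable (X : set (measurableTypeR R)) ->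
  lebesgue_measure ((fun x => x + c) @^-1` X) = lebesgue_measure X.
Proof.
move=> mX.
have mc : measurable_fun [set: measurableTypeR R]
    (fun x : measurableTypeR R => x + c : measurableTypeR R).
  by apply: measurable_funD => //; exact: measurable_id.
pose phi : {mfun measurableTypeR R >-> measurableTypeR R} :=
  HB.pack (fun x : measurableTypeR R => x + c : measurableTypeR R)
    (isMeasurableFun.Build _ _ _ _ _ mc).
rewrite -/(pushforward lebesgue_measure phi X).
apply/esym; apply: (@lebesgue_measure_unique R (pushforward lebesgue_measure phi)) => //=.
move=> _ [[a b]] _ <-.
rewrite /pushforward /=.
have -> : (fun x => x + c) @^-1` `]a, b] = `]a - c, b - c]%classic.
  by apply/seteqP; split=> x; rewrite /= !in_itv /= ltrBlDr lerBrDr.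
by rewrite !lebesgue_measure_itv /= !lte_fin ltrD2r; case: ifP => // _;
  rewrite -!EFinB; congr _%:E; ring.
Qed.

Lemma measurable_translate (R : realType) (d : R * R) :
  measurable_fun [set: plane R] (fun p : plane R => p + d : plane R).
Proof.
have -> : (fun p : plane R => p + d : plane R) = (fun p => (p.1 + d.1, p.2 + d.2)).
  by [].
by apply: measurable_fun_pair; apply: measurable_funD.
Qed.

Lemma area_translate (R : realType) (d : R * R) (X : set (R * R)) :
  measurable (X : set (plane R)) ->
  area_measure R ((fun p => p + d) @^-1` X) = area_measure R X.
Proof.
move=> mX.
pose phi : {mfun plane R >-> plane R} :=
  HB.pack (fun p : plane R => p + d : plane R)
    (isMeasurableFun.Build _ _ _ _ _ (measurable_translate d)).
rewrite -/(pushforward (area_measure R) phi X).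
apply/esym; apply: (@product_measure_unique _ _ _ _ R lebesgue_measure
  lebesgue_measure (pushforward (area_measure R) phi)) => //= A B mA mB.
rewrite /pushforward /=.
have -> : (fun p : R * R => p + d) @^-1` (A `*` B) =
  ((fun x => x + d.1) @^-1` A) `*` ((fun x => x + d.2) @^-1` B) by [].
have mt c (Y : set (measurableTypeR R)) : measurable Y ->
    measurable ((fun x : measurableTypeR R => x + c) @^-1` Y).
  move=> mY; rewrite -[X in measurable X]setTI.
  suff h : measurable_fun [set: measurableTypeR R]
    (fun x : measurableTypeR R => x + c : measurableTypeR R) by exact: h.
  by apply: measurable_funD => //; exact: measurable_id.
by rewrite area_setX ?lebesgue_measure_translate//; exact: mt.
Qed.

(** * Covering the boundary *)

(** If the segment from u to v avoided the boundary, it would be a connected subset of the union of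
    the separated sets D and the complement of closure D, meeting both. The bounds are
    coordinatewise, to suit the sup distance. *)
Lemma boundary_crossing (R : realType) (D : set (R * R)) (u v : R * R) :
  open D -> D u -> ~ D v -> exists w, (closure D `\` interior D) w /\
  `|w.1 - u.1| <= `|v.1 - u.1| /\ `|w.2 - u.2| <= `|v.2 - u.2|.
Proof.
move=> oD Du nDv.
pose f (t : R) : R * R := (u.1 + t * (v.1 - u.1), u.2 + t * (v.2 - u.2)).
have cf : continuous f.
  move=> t; have lin (x y : R) : x + r * y @[r --> t] --> x + t * y.
    by apply: cvgD; [exact: cvg_cst|apply: cvgM; [exact: cvg_id|exact: cvg_cst]].
  exact: (cvg_pair (lin u.1 (v.1 - u.1)) (lin u.2 (v.2 - u.2))).
apply: contrapT => noW.
have sub : f @` `[0, 1] `<=` D `|` ~` closure D.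
  move=> y [t t01 <-{y}]; move: t01; rewrite /= in_itv /= => /andP[t0 t1].
  apply: contrapT => /not_orP[nD /contrapT clD]; apply: noW.
  exists (f t); split; first by split=> // /interior_subset.
  have tn : `|t| <= 1 by rewrite ger0_norm.
  by rewrite /f /= !(addrC _ (t * _)) !addrK !normrM;
    split; rewrite ler_piMl.
have con : connected (f @` `[0, 1]).
  apply: connected_continuous_connected; first exact: segment_connected.
  exact: continuous_subspaceT.
have sep : separated D (~` closure D).
  split; apply/seteqP; split => // p [] //.
  move=> Dp clp; have := clp D (open_nbhs_nbhs (conj oD Dp)).
  by case=> q [nq Dq]; apply: nq; exact: subset_closure.
have f0 : f 0 = u by rewrite /f !mul0r !addr0; case: (u).
have f1 : f 1 = v.
  by rewrite /f !mul1r !subrKC; case: (v).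
have i0 : (f @` `[0, 1]) u by exists 0 => //=; rewrite in_itv /= lexx ler01.
have i1 : (f @` `[0, 1]) v by exists 1 => //=; rewrite in_itv /= lexx ler01.
case: (connected_subset sep sub con) => [/(_ _ i1)//|/(_ _ i0)]; apply.
exact: subset_closure.
Qed.

Lemma C1_lipschitz01 (R : realType) (g : R -> R) : C1 g ->
  exists2 K : R, 0 < K & forall x y, 0 <= x <= 1 -> 0 <= y <= 1 ->
    `|g x - g y| <= K * `|x - y|.
Proof.
move=> [dg cdg].
have [c _ cmax] : exists2 c : R, c \in `[0, 1] &
    forall t, t \in `[0, 1] -> `|derive1 g t| <= `|derive1 g c|.
  apply: EVT_max => //; apply: continuous_subspaceT => x.
  by apply: continuous_comp; [exact: cdg|exact: norm_continuous].
exists (`|derive1 g c| + 1); first by rewrite ltr_wpDl.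
have key x y : 0 <= x -> y <= 1 -> x <= y ->
    `|g y - g x| <= (`|derive1 g c| + 1) * `|y - x|.
  move=> x0 y1 xy.
  have [z] : exists2 z, z \in `[x, y] & g y - g x = derive1 g z * (y - x).
    apply: MVT_segment => // [z _|].
      by rewrite derive1E; exact: derivableP.
    by apply: derivable_within_continuous.
  rewrite in_itv /= => /andP[z1 z2] ->; rewrite normrM ler_wpM2r//.
  rewrite (le_trans (cmax z _)) ?lerDl//.
  by rewrite in_itv /= (le_trans x0 z1) (le_trans z2 y1).
move=> x y /andP[x0 x1] /andP[y0 y1].
have [xy|/ltW yx] := leP x y; last exact: key.
by rewrite distrC (distrC x); exact: key.
Qed.

(** A bound on one-dimensional content: at most c / s balls of radius s. The scale stops at 1
    because a nonempty set takes at least one ball, so s <= c. *)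
Definition covered_at_scale (R : realType) (c : R) (G : set (R * R)) : Prop :=
  forall s : R, 0 < s <= 1 -> exists l : seq (R * R),
    (size l)%:R * s <= c /\ forall w, G w -> exists2 z, z \in l & ball z s w.

Lemma smooth_arc_covered (R : realType) (G : set (R * R)) :
  smooth_arc G -> exists c, covered_at_scale c G.
Proof.
move=> [g1 [g2 [/C1_lipschitz01[K1 K10 h1] /C1_lipschitz01[K2 K20 h2] _ ->]]].
pose K := K1 + K2; have K0 : 0 < K by rewrite addr_gt0.
(* Sampling at j / n for 0 <= j <= n, with n just above K / s, uses n + 1 points, and (n + 1) s <= K
   + 2 s <= K + 2. *)
exists (K + 2) => s /andP[s0 s1].
pose n := (Num.truncn (K / s)).+1.
have n0 : 0 < n%:R :> R by rewrite ltr0n.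
have Ks0 : 0 <= K / s by rewrite divr_ge0 ?ltW.
have /andP[nlo nhi] := truncn_itv Ks0; rewrite -/n in nhi.
have nKs : n%:R * s <= K + s.
  by rewrite /n -natr1 mulrDl mul1r lerD2r -ler_pdivlMr.
pose pt (j : nat) : R * R := (g1 (j%:R / n%:R), g2 (j%:R / n%:R)).
have mem_pt j : (j <= n)%N -> pt j \in [seq pt j | j <- iota 0 n.+1].
  by move=> jn; apply: map_f; rewrite mem_iota add0n ltnS.
exists [seq pt j | j <- iota 0 n.+1]; split.
  rewrite size_map size_iota -natr1 mulrDl mul1r; lra.
move=> w [x /=]; rewrite in_itv /= => /andP[x0 x1] <-.
have xn0 : 0 <= x * n%:R by rewrite mulr_ge0// ltW.
pose j := Num.truncn (x * n%:R).
have /andP[jlo jhi] := truncn_itv xn0; rewrite -/j in jlo jhi.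
have jn : (j <= n)%N.
  rewrite -(ler_nat R) (le_trans jlo)// -[leRHS]mul1r ler_wpM2r// ltW.
exists (pt j); first exact: mem_pt.
have jx : 0 <= (j%:R / n%:R : R) <= 1.
  by rewrite divr_ge0//= ler_pdivrMr// mul1r ler_nat.
have xx : 0 <= x <= 1 by rewrite x0.
have dist : `|j%:R / n%:R - x| <= n%:R^-1.
  rewrite distrC ger0_norm ?subr_ge0 ?ler_pdivrMr//.
  rewrite lerBlDr -{1}[n%:R^-1]mul1r -mulrDl ler_pdivlMr// addrC natr1 ltW//.
have Kn : K / n%:R < s by rewrite ltr_pdivrMr// mulrC -ltr_pdivrMr.
have bnd Ki : 0 < Ki -> Ki <= K -> Ki * `|j%:R / n%:R - x| < s.
  move=> Ki0 KiK; apply: le_lt_trans Kn; apply: ler_pM => //; exact: ltW.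
split; rewrite /ball /=.
  by rewrite (le_lt_trans (h1 (j%:R / n%:R) x jx xx))// bnd// /K lerDl ltW.
by rewrite (le_lt_trans (h2 (j%:R / n%:R) x jx xx))// bnd// /K lerDr ltW.
Qed.

Lemma shape_boundary_covered (R : realType) (D : set (R * R)) :
  piecewise_smooth_boundary D ->
  exists c, covered_at_scale c (closure D `\` interior D).
Proof.
move=> [n [G [hG ->]]].
have /choice[c hc] i := smooth_arc_covered (hG i).
exists (\sum_i c i) => s hs.
have /choice[l hl] i := hc i s hs.
exists (flatten [seq l i | i <- enum 'I_n]); split.
  rewrite size_flatten /shape -map_comp sumnE big_map big_enum /= natr_sum.
  by rewrite mulr_suml; apply: ler_sum => i _; case: (hl i).
move=> w [i _ Gw]; have [_ /(_ _ Gw)[z zl bz]] := hl i.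
exists z => //; apply/flattenP; exists (l i) => //.
by apply: map_f; rewrite mem_enum.
Qed.

(** * The scaled array: measurability, extent and area *)

Section ScaledArray.
Variables (R : realType) (D : set (R * R)).

Lemma scaled_arrayP (a : R) (x : R * R) : 0 < a ->
  scaled_array a D x <-> D (a^-1 * x.1, a^-1 * x.2).
Proof.
move=> a0; have an0 : a != 0 by rewrite gt_eqF.
split=> [[p Dp <-] /=|Dx]; first by rewrite !mulKf//; case: p Dp.
by exists (a^-1 * x.1, a^-1 * x.2) => //=; rewrite !mulVKf//; case: x Dx.
Qed.

Lemma scaled_array_open (a : R) : 0 < a -> open D -> open (scaled_array a D).
Proof.
move=> a0 oD.
have -> : scaled_array a D = (fun x => (a^-1 * x.1, a^-1 * x.2)) @^-1` D.
  by apply/seteqP; split=> x; move/(scaled_arrayP x a0).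
apply: open_comp => // x _.
have h1 : a^-1 * q.1 @[q --> x] --> a^-1 * x.1.
  by apply: cvgM; [exact: cvg_cst|exact: cvg_fst].
have h2 : a^-1 * q.2 @[q --> x] --> a^-1 * x.2.
  by apply: cvgM; [exact: cvg_cst|exact: cvg_snd].
exact: (cvg_pair h1 h2).
Qed.

Lemma ball_scale (a s : R) (z x : R * R) : 0 < a ->
  ball z s (a^-1 * x.1, a^-1 * x.2) -> ball (a * z.1, a * z.2) (a * s) x.
Proof.
move=> a0 [b1 b2]; rewrite /ball /= in b1 b2.
have key (u v : R) : `|u - a^-1 * v| < s -> `|a * u - v| < a * s.
  move=> h; rewrite -[v](mulVKf (lt0r_neq0 a0)) -mulrBr normrM gtr0_norm//.
  by rewrite ltr_pM2l.
by split; rewrite /ball /=; apply: key.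
Qed.

Lemma ball_unscale (a s : R) (z x : R * R) : 0 < a ->
  ball (a * z.1, a * z.2) (a * s) x -> ball z s (a^-1 * x.1, a^-1 * x.2).
Proof.
move=> a0 [b1 b2]; rewrite /ball /= in b1 b2.
have key (u v : R) : `|a * u - v| < a * s -> `|u - a^-1 * v| < s.
  rewrite -[X in `|_ - X| < _](mulVKf (lt0r_neq0 a0)) -mulrBr normrM gtr0_norm//.
  by rewrite ltr_pM2l.
by split; rewrite /ball /=; apply: key.
Qed.

Hypothesis hD : planar_shape D.

Lemma scaled_array_measurable (a : R) : 0 < a ->
  measurable (scaled_array a D : set (plane R)).
Proof.
case: hD => _ oD _ _ _ a0; apply: open_plane_measurable.
exact: scaled_array_open.
Qed.

Lemma shape_sub_ball : exists2 r : R, 0 < r & D `<=` ball (0, 0) r.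
Proof.
case: hD => _ _ _ [r [rr bD]] _.
exists (`|r| + 2); first by rewrite ltr_wpDl.
move=> p Dp; have := bD (`|r| + 1) _ p Dp.
rewrite (le_lt_trans (ler_norm r)) ?ltrDl// => /(_ isT) np.
have [n1 n2] : `|p.1| <= `|r| + 1 /\ `|p.2| <= `|r| + 1.
  by move: np; rewrite /= prod_normE ge_max => /andP[].
by split; rewrite /ball /= sub0r normrN; lra.
Qed.

(** The shape contains a square of radius e and lies in one of radius r; scaling both by a gives
    areas of order a^2. *)
Lemma scaled_array_bounds : exists2 c : R, 1 <= c & forall a : R, 0 < a ->
  [/\ (forall p, scaled_array a D p -> `|p.1| <= c * a /\ `|p.2| <= c * a),
      (area_measure R (scaled_array a D) < +oo)%E,
      a ^+ 2 / c <= mes (scaled_array a D) &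
      mes (scaled_array a D) <= c * a ^+ 2].
Proof.
have [r r0 Dr] := shape_sub_ball.
case: (hD) => -[u Du] oD _ _ _.
have [e e0 eD] : exists2 e : R, 0 < e & ball u e `<=` D.
  by move: oD; rewrite openE => /(_ _ Du) /nbhs_ballP[e /= e0 eD]; exists e.
(* The four summands serve in turn the upper bound on the area, the lower bound, the extent, and 1
   <= c. *)
pose c := (2 * r) ^+ 2 + ((2 * e) ^+ 2)^-1 + r + 1.
have e20 : 0 < (2 * e) ^+ 2 by rewrite exprn_gt0// mulr_gt0.
have r20 : 0 <= (2 * r) ^+ 2 by rewrite sqr_ge0.
have e2v : 0 < ((2 * e) ^+ 2)^-1 by rewrite invr_gt0.
exists c; first by rewrite /c; lra.
move=> a a0.
have mA := scaled_array_measurable a0.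
have ub : scaled_array a D `<=` ball (0, 0) (a * r).
  move=> x /(scaled_arrayP _ a0) /Dr /(ball_scale a0) /=.
  by rewrite mulr0.
have lb : ball (a * u.1, a * u.2) (a * e) `<=` scaled_array a D.
  by move=> x /(ball_unscale a0) /eD /scaled_arrayP; apply.
have are0 : 0 <= a * r by rewrite ltW// mulr_gt0.
have aee0 : 0 <= a * e by rewrite ltW// mulr_gt0.
have lef : (area_measure R (scaled_array a D) <= ((2 * (a * r)) ^+ 2)%:E)%E.
  by rewrite -(area_ball (0, 0) are0) le_measure// inE//; exact: measurable_plane_ball.
have gef : (((2 * (a * e)) ^+ 2)%:E <= area_measure R (scaled_array a D))%E.
  rewrite -(area_ball (a * u.1, a * u.2) aee0) le_measure// inE//.
  exact: measurable_plane_ball.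
have fin : (area_measure R (scaled_array a D) < +oo)%E.
  by rewrite (le_lt_trans lef) ?ltry.
have fine_num : area_measure R (scaled_array a D) \is a fin_num.
  by rewrite ge0_fin_numE.
split=> //.
- move=> p /ub [] /=; rewrite /ball /= !sub0r !normrN => p1 p2.
  have arc : a * r <= c * a by rewrite mulrC ler_wpM2r ?ltW// /c; lra.
  by split; rewrite (le_trans _ arc)// ltW.
- rewrite -lee_fin /mes fineK// (le_trans _ gef)// lee_fin.
  rewrite ler_pdivrMr; last by rewrite /c; lra.
  have -> : (2 * (a * e)) ^+ 2 = a ^+ 2 * (2 * e) ^+ 2 by ring.
  rewrite -mulrA ler_peMr ?sqr_ge0// mulrC -ler_pdivrMr// mul1r /c; lra.
- rewrite -lee_fin /mes fineK// (le_trans lef)// lee_fin.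
  have -> : (2 * (a * r)) ^+ 2 = (2 * r) ^+ 2 * a ^+ 2 by ring.
  by rewrite ler_wpM2r ?sqr_ge0// /c; lra.
Qed.

End ScaledArray.

(** * Bounded functions on sets of finite area *)

Section BoundedIntegrals.
Variable R : realType.
Local Notation mu := (area_measure R).

Lemma bounded_area_integrable (A : set (plane R)) (f : plane R -> R) (c : R) :
  measurable A -> (mu A < +oo)%E -> measurable_fun setT f ->
  (forall p, A p -> `|f p| <= c) -> mu.-integrable A (EFin \o f).
Proof.
move=> mA fA mf fc; apply: measurable_bounded_integrable => //.
  exact: measurable_funTS.
exists c; split; first exact: num_real.
by move=> x cx p Ap; apply: (le_trans (fc _ Ap)); rewrite ltW.
Qed.

Lemma le_Rintegral_area (A : set (plane R)) (f : plane R -> R) (c : R) :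
  measurable A -> (mu A < +oo)%E -> measurable_fun setT f ->
  (forall p, A p -> `|f p| <= c) ->
  `|\int[mu]_(p in A) f p| <= c * fine (mu A).
Proof.
move=> mA fA mf fc.
have intf := bounded_area_integrable mA fA mf fc.
apply: (le_trans (le_normr_Rintegral mA intf)).
rewrite -(Rintegral_cst _ mA); apply: le_Rintegral => //.
  exact: (integrable_norm intf).
apply: (@bounded_area_integrable A (cst c) `|c|) => //.
Qed.

End BoundedIntegrals.

(** * Oscillatory integrals over the array *)

Lemma Rintegral_measure_preserving d (T : measurableType d) (R : realType)
    (mu : {measure set T -> \bar R}) (phi : T -> T) (f : T -> R) (X : set T) :
  measurable_fun setT phi ->
  (forall A, measurable A -> mu (phi @^-1` A) = mu A) ->
  measurable X -> measurable_fun setT f ->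
  mu.-integrable (phi @^-1` X) (EFin \o (f \o phi)) ->
  \int[mu]_(p in phi @^-1` X) f (phi p) = \int[mu]_(p in X) f p.
Proof.
move=> mphi same mX mf intf.
pose phim : {mfun T >-> T} := HB.pack phi (isMeasurableFun.Build _ _ _ _ _ mphi).
have := integral_pushforward mphi ((measurable_EFinP _ _).2 mf) intf mX.
rewrite /Rintegral => E; congr fine; rewrite -[LHS]E.
by apply: (@eq_measure_integral _ _ _ X mu (pushforward mu phim)) => A mA _; exact: same.
Qed.

Section Oscillation.
Variable R : realType.
Local Notation mu := (area_measure R).

Lemma measurable_preimage_translate (d : R * R) (X : set (plane R)) :
  measurable X -> measurable ((fun p => p + d) @^-1` X : set (plane R)).
Proof.
move=> mX; rewrite -[X in measurable X]setTI.
by have := @measurable_translate R d; apply.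
Qed.

Lemma Rintegral_translate (d : R * R) (X : set (plane R)) (f : plane R -> R) (c : R) :
  measurable X -> (mu X < +oo)%E -> measurable_fun setT f ->
  (forall p, `|f p| <= c) ->
  \int[mu]_(p in (fun p => p + d) @^-1` X) f (p + d) = \int[mu]_(p in X) f p.
Proof.
move=> mX fX mf fc.
have mphi : measurable_fun [set: plane R] (fun p : plane R => p + d : plane R).
  exact: measurable_translate.
apply: (Rintegral_measure_preserving mphi) => //.
  by move=> A mA; exact: area_translate.
apply: (@bounded_area_integrable _ _ (fun p : plane R => f (p + d)) c) => //.
- exact: measurable_preimage_translate.
- by rewrite area_translate.
- exact: measurableT_comp mf mphi.
Qed.

(* Translating by a half period d changes the sign of f, so that twice the
   integral over A lives on the symmetric difference of A and A - d. *)
Lemma antiperiodic_Rintegral (A B : set (plane R)) (f : plane R -> R) (d : R * R) :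
  measurable A -> (mu A < +oo)%E -> measurable B -> (mu B < +oo)%E ->
  measurable_fun setT f ->
  (forall p, `|f p| <= 1) -> (forall p, f (p + d) = - f p) ->
  (forall p, A p -> ~ A (p + d) -> B p) ->
  (forall p, A (p + d) -> ~ A p -> B p) ->
  `|\int[mu]_(p in A) f p| <= fine (mu B).
Proof.
move=> mA fA mB fB mf f1 fd AB BA.
pose A' : set (plane R) := (fun p => p + d) @^-1` A.
have mA' : measurable A' by exact: measurable_preimage_translate.
have fA' : (mu A' < +oo)%E by rewrite area_translate.
have intf (X : set (plane R)) : measurable X -> (mu X < +oo)%E ->
    mu.-integrable X (EFin \o f).
  by move=> mX fX; exact: (bounded_area_integrable mX fX mf (fun p _ => f1 p)).
have split_int (X Y : set (plane R)) : measurable X -> (mu X < +oo)%E ->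
    measurable Y ->
    \int[mu]_(p in X) f p = \int[mu]_(p in X `&` Y) f p + \int[mu]_(p in X `\` Y) f p.
  move=> mX fX mY.
  rewrite -[in LHS](setUIDK X Y) Rintegral_setU//.
  - exact: measurableI.
  - exact: measurableD.
  - by rewrite setUIDK; exact: intf.
  - by apply/disj_setPS => p [[_ Yp] [_ /(_ Yp)]].
have small (X Y : set (plane R)) : measurable X -> (mu X < +oo)%E ->
    measurable Y -> (forall p, X p -> ~ Y p -> B p) ->
    `|\int[mu]_(p in X `\` Y) f p| <= fine (mu B).
  move=> mX fX mY XYB.
  have mD : measurable (X `\` Y) by exact: measurableD.
  have lB : (mu (X `\` Y) <= mu B)%E.
    by rewrite le_measure// ?inE// => p [/XYB].
  have fD : (mu (X `\` Y) < +oo)%E by exact: le_lt_trans lB fB.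
  apply: le_trans (le_Rintegral_area mD fD mf (fun p _ => f1 p)) _.
  by rewrite mul1r fine_le// ge0_fin_numE.
have E : \int[mu]_(p in A) f p = - \int[mu]_(p in A') f p.
  rewrite -(Rintegral_translate d mA fA mf f1) -/A'.
  under eq_Rintegral do rewrite fd -mulN1r.
  by rewrite RintegralZl ?mulN1r//; exact: intf.
have E1 := split_int A A' mA fA mA'.
have E2 := split_int A' A mA' fA' mA.
have s1 := small A A' mA fA mA' AB.
have s2 := small A' A mA' fA' mA BA.
rewrite setIC in E2.
(* With z the integral over the common part, x = z + y, x' = z + y' and x = - x' give x = (y - y') /
   2, so z drops out. *)
move: E E1 E2 s1 s2.
move: (\int[mu]_(p in A) f p) (\int[mu]_(p in A') f p) (\int[mu]_(p in A `&` A') f p)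
  (\int[mu]_(p in A `\` A') f p) (\int[mu]_(p in A' `\` A) f p) (fine _).
move=> x x' z y y' m xx' xE x'E; rewrite !ler_norml => /andP[? ?] /andP[? ?].
by apply/andP; split; lra.
Qed.

Lemma area_bigcup_balls (l : seq (R * R)) (e : R) : 0 <= e ->
  let B := \big[setU/set0]_(z <- l) ball z e in
  measurable (B : set (plane R)) /\
  (mu B <= ((size l)%:R * (2 * e) ^+ 2)%:E)%E.
Proof.
move=> e0; elim: l => [|z l [mB leB]] B.
  by rewrite /B big_nil measure0 mul0r; split => //; exact: measurable0.
rewrite /B big_cons; split.
  by apply: measurableU => //; exact: measurable_plane_ball.
apply: (le_trans (measureU2 _ _ _)) => //; first exact: measurable_plane_ball.
rewrite /= -natr1 addrC mulrDl mul1r EFinD leeD//.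
by rewrite -(area_ball z e0).
Qed.

(** A point that enters or leaves the array under translation by d lies within O(e) of the scaled
    boundary. Covering the boundary of the shape at scale s = e / a takes at most K / s balls;
    scaled and enlarged to radius 3 e, each has area 36 e^2, for a total of at most 36 K a e. *)
Lemma antiperiodic_scaled_array (D : set (R * R)) : planar_shape D ->
  exists2 c : R, 0 < c & forall (a e : R) (d : R * R) (f : plane R -> R),
  0 < a -> 0 < e -> `|d.1| <= e -> `|d.2| <= e ->
  measurable_fun setT f -> (forall p, `|f p| <= 1) ->
  (forall p, f (p + d) = - f p) ->
  `|\int[mu]_(p in scaled_array a D) f p| <= c * a * e.
Proof.
move=> hD; have [c c1 hc] := scaled_array_bounds hD.
have c0 : 0 < c by exact: lt_le_trans c1.
have [K hK] : exists K, covered_at_scale K (closure D `\` interior D).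
  by case: hD => _ _ _ _; exact: shape_boundary_covered.
have K0 : 0 <= K.
  have [l [lK _]] := hK 1 (andb_true_intro (conj ltr01 (lexx _))).
  by rewrite (le_trans _ lK)// mulr1.
exists (c + 36 * K); first by rewrite ltr_wpDr// mulr_ge0.
move=> a e d f a0 e0 d1 d2 mf f1 fd.
have [_ fA _ mesA] := hc a a0.
have mA := scaled_array_measurable hD a0.
have ae0 : 0 < a * e by rewrite mulr_gt0.
have K16 : 0 <= 36 * K by rewrite mulr_ge0.
(* The covering is available only for e / a <= 1. Otherwise the trivial bound mes A <= c a^2 <= c a
   e is enough. *)
have [ea|ae] := leP e a; last first.
  apply: le_trans (le_Rintegral_area mA fA mf (fun p _ => f1 p)) _.
  rewrite mul1r (le_trans mesA)// -mulrA.
  rewrite mulrDl ler_wpDr ?mulr_ge0 ?(ltW e0) ?(ltW a0) ?(ltW ae0)//.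
  by rewrite ler_wpM2l ?(ltW c0)// expr2 ler_wpM2l ?(ltW a0)// ltW.
pose s := e / a.
have s0 : 0 < s by rewrite divr_gt0.
have s1 : s <= 1 by rewrite ler_pdivrMr// mul1r.
have [l [lK cov]] := hK s (andb_true_intro (conj s0 s1)).
pose l' := [seq (a * z.1, a * z.2) | z <- l].
have e20 : 0 <= 3 * e by rewrite mulr_ge0// ltW.
have [mB leB] := area_bigcup_balls l' e20.
set B := \big[_/_]_(_ <- _) _ in mB leB.
have fB : (mu B < +oo)%E by rewrite (le_lt_trans leB) ?ltry.
have inB (x y p : R * R) : scaled_array a D x -> ~ scaled_array a D y ->
    `|y.1 - x.1| <= e -> `|y.2 - x.2| <= e -> p = x \/ p = y -> B p.
  move=> /(scaled_arrayP _ _ a0) Dx nDy yx1 yx2 pxy.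
  have nDy' : ~ D (a^-1 * y.1, a^-1 * y.2) by move/(scaled_arrayP _ _ a0).
  have oD : open D by case: hD.
  have [w [bw [w1 w2]]] := boundary_crossing oD Dx nDy'.
  have [z zl bz] := cov w bw.
  have sc (u v : R) : `|u - v| <= e -> `|a^-1 * u - a^-1 * v| <= s.
    rewrite -mulrBr normrM gtr0_norm ?invr_gt0// mulrC /s.
    by move=> ?; rewrite ler_wpM2r// invr_ge0 ltW.
  (* The centre z is within s of the boundary point w, which is within s of x, which is within s of
     y: radius 3 s reaches both ends. *)
  have tri (zz ww xx yy : R) : `|zz - ww| < s -> `|ww - xx| <= `|yy - xx| ->
      `|yy - xx| <= s -> `|zz - xx| < 3 * s /\ `|zz - yy| < 3 * s.
    move=> h1 h2 h3; have h4 := le_trans h2 h3; move: h1 h3 h4 {h2}.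
    rewrite !ltr_norml !ler_norml => /andP[? ?] /andP[? ?] /andP[? ?].
    by split; apply/andP; split; lra.
  have [[x1 y1] [x2 y2]] := (tri _ _ _ _ bz.1 w1 (sc _ _ yx1), tri _ _ _ _ bz.2 w2 (sc _ _ yx2)).
  have hp : ball (a * z.1, a * z.2) (3 * e) p.
    have -> : 3 * e = a * (3 * s) by rewrite /s; field; rewrite gt_eqF.
    by apply: ball_scale => //; case: pxy => ->; split.
  rewrite /B big_map; elim: l zl {cov lK l' leB mB B fB} => //= z' l IH.
  rewrite inE big_cons => /orP[/eqP <-|/IH]; [by left|by right].
apply: le_trans (antiperiodic_Rintegral mA fA mB fB mf f1 fd _ _) _.
- move=> p Ap nApd; apply: (inB p (p + d) p) => //; last by left.
    by rewrite /= addrAC subrr add0r.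
  by rewrite /= addrAC subrr add0r.
- move=> p Apd nAp; apply: (inB (p + d) p p) => //; last by right.
    by rewrite /= opprD addrA subrr sub0r normrN.
  by rewrite /= opprD addrA subrr sub0r normrN.
- apply: (@le_trans _ _ ((size l')%:R * (2 * (3 * e)) ^+ 2)).
    by rewrite -lee_fin fineK// ge0_fin_numE.
  have -> : (size l')%:R * (2 * (3 * e)) ^+ 2 = 36 * ((size l)%:R * s) * (a * e).
    by rewrite size_map /s; field; rewrite gt_eqF.
  rewrite -[leRHS]mulrA ler_wpM2r ?(ltW ae0)// (@le_trans _ _ (36 * K))//.
    by rewrite ler_wpM2l.
  by rewrite ler_wpDl// ltW.
Qed.
End Oscillation.

(** * The real-valued modulus of complex numbers *)

Notation cnorm := (@Normc.normc _).

Section ComplexNorm.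
Variable R : realType.
Implicit Types z w : R[i].

Lemma cnorm_ge0 z : 0 <= cnorm z.
Proof. by case: z => x y; exact: sqrtr_ge0. Qed.

Lemma cnormD z w : cnorm (z + w) <= cnorm z + cnorm w.
Proof. exact: le_normcD. Qed.

Lemma cnormN z : cnorm (- z) = cnorm z.
Proof. exact: normcN. Qed.

Lemma cnormM z w : cnorm (z * w) = cnorm z * cnorm w.
Proof. exact: Normc.normcM. Qed.

Lemma cnormB z w : cnorm (z - w) <= cnorm z + cnorm w.
Proof. by rewrite -(cnormN w); exact: cnormD. Qed.

Lemma cnorm_conj z : cnorm (z^*)%C = cnorm z.
Proof. by case: z => x y; rewrite /= sqrrN. Qed.

Lemma cnorm_real (x : R) : cnorm x%:C%C = `|x|.
Proof. by rewrite /= expr0n addr0 sqrtr_sqr. Qed.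

Lemma cnorm_sum (I : Type) (r : seq I) (P : pred I) (F : I -> R[i]) :
  cnorm (\sum_(i <- r | P i) F i) <= \sum_(i <- r | P i) cnorm (F i).
Proof.
elim/big_rec2: _ => [|i x z _ h]; first by rewrite Normc.normc0.
by rewrite (le_trans (cnormD _ _))// lerD2l.
Qed.

Lemma Re_le_cnorm z : `|complex.Re z| <= cnorm z.
Proof. by case: z => x y; rewrite /= -sqrtr_sqr ler_wsqrtr// lerDl sqr_ge0. Qed.

Lemma Im_le_cnorm z : `|complex.Im z| <= cnorm z.
Proof. by case: z => x y; rewrite /= -sqrtr_sqr ler_wsqrtr// lerDr sqr_ge0. Qed.

Lemma cnorm_le_ReIm z : cnorm z <= `|complex.Re z| + `|complex.Im z|.
Proof.
case: z => x y /=; rewrite -[leRHS]ger0_norm ?addr_ge0// -sqrtr_sqr ler_wsqrtr//.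
by rewrite sqrrD !real_normK ?num_real// addrAC lerDl mulrn_wge0// mulr_ge0.
Qed.

End ComplexNorm.

(** * Integrals of complex functions over the array *)

Section ComplexIntegral.
Variable R : realType.
Local Notation mu := (area_measure R).

(** Shaped so that an entry of [mx_integral A F] is, by computation, the [cint] of that entry. *)
Definition cint (A : set (R * R)) (f : plane R -> R[i]) : R[i] :=
  Complex (\int[mu]_(p in A) complex.Re (f p)) (\int[mu]_(p in A) complex.Im (f p)).

Definition cmeas (f : plane R -> R[i]) : Prop :=
  measurable_fun setT (fun p => complex.Re (f p)) /\
  measurable_fun setT (fun p => complex.Im (f p)).

Lemma cmeas_cst z : cmeas (fun=> z).
Proof. by split; exact: measurable_cst. Qed.

Lemma cmeasD f g : cmeas f -> cmeas g -> cmeas (fun p => f p + g p).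
Proof.
move=> [f1 f2] [g1 g2]; split.
  rewrite (_ : (fun p => _) = (fun p => complex.Re (f p)) \+ (fun p => complex.Re (g p))).
    exact: measurable_funD.
  by apply/funext => p /=; case: (f p) (g p) => [? ?] [? ?].
rewrite (_ : (fun p => _) = (fun p => complex.Im (f p)) \+ (fun p => complex.Im (g p))).
  exact: measurable_funD.
by apply/funext => p /=; case: (f p) (g p) => [? ?] [? ?].
Qed.

Lemma cmeasM f g : cmeas f -> cmeas g -> cmeas (fun p => f p * g p).
Proof.
move=> [f1 f2] [g1 g2]; split.
  rewrite (_ : (fun p => _) =
     (fun p => complex.Re (f p)) \* (fun p => complex.Re (g p)) \-
     (fun p => complex.Im (f p)) \* (fun p => complex.Im (g p))).
    by apply: measurable_funB; exact: measurable_funM.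
  by apply/funext => p /=; case: (f p) (g p) => [? ?] [? ?].
rewrite (_ : (fun p => _) =
   (fun p => complex.Re (f p)) \* (fun p => complex.Im (g p)) \+
   (fun p => complex.Im (f p)) \* (fun p => complex.Re (g p))).
  by apply: measurable_funD; exact: measurable_funM.
by apply/funext => p /=; case: (f p) (g p) => [? ?] [? ?].
Qed.

Lemma cmeasN f : cmeas f -> cmeas (fun p => - f p).
Proof.
move=> mf; rewrite (_ : (fun p => _) = (fun p => -1 * f p)).
  by apply: cmeasM => //; exact: cmeas_cst.
by apply/funext => p; rewrite mulN1r.
Qed.

Lemma cmeasB f g : cmeas f -> cmeas g -> cmeas (fun p => f p - g p).
Proof. by move=> mf mg; apply: cmeasD => //; exact: cmeasN. Qed.

Lemma cmeas_conj f : cmeas f -> cmeas (fun p => (f p)^*%C).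
Proof.
move=> [f1 f2]; split.
  rewrite (_ : (fun p => _) = (fun p => complex.Re (f p)))//.
  by apply/funext => p /=; case: (f p).
rewrite (_ : (fun p => _) = \- (fun p => complex.Im (f p))); first exact: measurable_funN.
by apply/funext => p /=; case: (f p).
Qed.

Lemma cmeas_sum (I : Type) (r : seq I) (F : I -> plane R -> R[i]) :
  (forall i, cmeas (F i)) -> cmeas (fun p => \sum_(i <- r) F i p).
Proof.
move=> mF; elim: r => [|i r IH].
  by under eq_fun do rewrite big_nil; exact: cmeas_cst.
by under eq_fun do rewrite big_cons; exact: cmeasD.
Qed.

Lemma cmeas_real (f : plane R -> R) :
  measurable_fun setT f -> cmeas (fun p => (f p)%:C%C).
Proof. by move=> mf; split => //=; exact: measurable_cst. Qed.

Lemma cmeas_expi (f : plane R -> R) :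
  measurable_fun setT f -> cmeas (fun p => expi (f p)).
Proof.
move=> mf; split => /=.
  apply: (measurableT_comp _ mf); apply: continuous_measurable_fun.
  exact: continuous_cos.
apply: (measurableT_comp _ mf); apply: continuous_measurable_fun.
exact: continuous_sin.
Qed.

(** The form of integrability used throughout: it is checked without computing any integral and
    yields integrability of both parts once A has finite area. *)
Definition cbounded (A : set (R * R)) (f : plane R -> R[i]) : Prop :=
  cmeas f /\ exists c, forall p, A p -> cnorm (f p) <= c.

Lemma cbounded_cst A z : cbounded A (fun=> z).
Proof. by split; [exact: cmeas_cst|exists (cnorm z)]. Qed.

Lemma cboundedD A f g : cbounded A f -> cbounded A g ->
  cbounded A (fun p => f p + g p).
Proof.
move=> [mf [c hc]] [mg [d hd]]; split; first exact: cmeasD.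
by exists (c + d) => p Ap; rewrite (le_trans (cnormD _ _))// lerD ?hc ?hd.
Qed.

Lemma cbounded_sum A (I : Type) (r : seq I) (F : I -> plane R -> R[i]) :
  (forall i, cbounded A (F i)) -> cbounded A (fun p => \sum_(i <- r) F i p).
Proof.
move=> mF; elim: r => [|i r IH].
  by under eq_fun do rewrite big_nil; exact: cbounded_cst.
by under eq_fun do rewrite big_cons; exact: cboundedD.
Qed.

Section OnSet.
Variables (A : set (plane R)) (mA : measurable A) (fA : (mu A < +oo)%E).

Lemma cbounded_integrable f : cbounded A f ->
  mu.-integrable A (EFin \o (fun p => complex.Re (f p))) /\
  mu.-integrable A (EFin \o (fun p => complex.Im (f p))).
Proof.
move=> [[m1 m2] [c hc]]; split; apply: (bounded_area_integrable (c := c)) => // p Ap.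
  exact: le_trans (Re_le_cnorm _) (hc _ Ap).
exact: le_trans (Im_le_cnorm _) (hc _ Ap).
Qed.

Lemma cintD f g : cbounded A f -> cbounded A g ->
  cint A (fun p => f p + g p) = cint A f + cint A g.
Proof.
move=> /cbounded_integrable[f1 f2] /cbounded_integrable[g1 g2].
rewrite /cint [RHS]/GRing.add /=; congr Complex.
  rewrite -RintegralD//; apply: eq_Rintegral => p _.
  by case: (f p) (g p) => [? ?] [? ?].
rewrite -RintegralD//; apply: eq_Rintegral => p _.
by case: (f p) (g p) => [? ?] [? ?].
Qed.

Lemma cintZ f z : cbounded A f -> cint A (fun p => z * f p) = z * cint A f.
Proof.
case: z => x y bf; have [f1 f2] := cbounded_integrable bf.
have intZ (g : plane R -> R) (c : R) : mu.-integrable A (EFin \o g) ->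
    mu.-integrable A (EFin \o (fun p => c * g p)).
  by move=> ig; have := integrableZl mA c ig; apply: eq_integrable.
rewrite /cint [RHS]/GRing.mul /=; congr Complex; rewrite -!RintegralZl//.
  rewrite -RintegralB//; [|exact: intZ..].
  by apply: eq_Rintegral => p _; case: (f p).
rewrite -RintegralD//; [|exact: intZ..].
by apply: eq_Rintegral => p _; case: (f p).
Qed.

Lemma cint_sum (I : Type) (r : seq I) (F : I -> plane R -> R[i]) :
  (forall i, cbounded A (F i)) ->
  cint A (fun p => \sum_(i <- r) F i p) = \sum_(i <- r) cint A (F i).
Proof.
move=> bF; elim: r => [|i r IH].
  rewrite big_nil; under eq_fun do rewrite big_nil.
  rewrite -[RHS](mul0r (cint A (fun=> 1))) -cintZ; last exact: cbounded_cst.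
  by congr cint; apply/funext => p; rewrite mul0r.
rewrite big_cons -IH -cintD//; last exact: cbounded_sum.
by congr cint; apply/funext => p; rewrite big_cons.
Qed.

(** The real and imaginary parts are bounded separately, hence the factor 2. *)
Lemma cnorm_cint_le f c : cmeas f -> (forall p, A p -> cnorm (f p) <= c) ->
  cnorm (cint A f) <= 2 * c * mes A.
Proof.
move=> [f1 f2] hc; rewrite (le_trans (cnorm_le_ReIm _))//=.
rewrite -mulrA mulrDl !mul1r lerD//; apply: le_Rintegral_area => // p Ap.
  exact: le_trans (Re_le_cnorm _) (hc _ Ap).
exact: le_trans (Im_le_cnorm _) (hc _ Ap).
Qed.

End OnSet.

(** For the frequency x = (x1, x2), the half period is d = pi x / |x|^2: the phase grows by x . d =
    pi, so sine and cosine change sign, and the coordinates of d are at most pi / |x|. Each of the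
    two parts costs c a pi / |x|. *)
Lemma cint_linear_phase (D : set (R * R)) : planar_shape D ->
  exists2 c : R, 0 < c & forall (a x1 x2 t : R), 0 < a -> (x1, x2) != (0, 0) ->
  cnorm (cint (scaled_array a D) (fun p => expi (x1 * p.1 + x2 * p.2 + t))) <=
    c * a / Num.sqrt (x1 ^+ 2 + x2 ^+ 2).
Proof.
move=> hD; have [c c0 hc] := antiperiodic_scaled_array hD.
have pi0 : 0 < pi :> R := pi_gt0 R.
exists (2 * c * pi); first by rewrite !mulr_gt0.
move=> a x1 x2 t a0 x0.
pose q := x1 ^+ 2 + x2 ^+ 2.
have q0 : 0 < q.
  rewrite lt0r addr_ge0 ?sqr_ge0// andbT paddr_eq0 ?sqr_ge0// !sqrf_eq0.
  by apply: contra x0 => /andP[/eqP-> /eqP->].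
pose r := Num.sqrt q; have r0 : 0 < r by rewrite sqrtr_gt0.
have r2 : r * r = q by rewrite -expr2 sqr_sqrtr// ltW.
pose d : R * R := (pi * x1 / q, pi * x2 / q).
have dle (x : R) : `|x| <= r -> `|pi * x / q| <= pi / r.
  move=> xr; rewrite !normrM normfV (gtr0_norm q0) (gtr0_norm pi0) -mulrA.
  rewrite ler_pM2l// -r2 invfM mulrA ler_piMl ?invr_ge0 ?(ltW r0)//.
  by rewrite ler_pdivrMr// mul1r.
have [x1r x2r] : `|x1| <= r /\ `|x2| <= r.
  by split; rewrite -sqrtr_sqr ler_wsqrtr// ?lerDl ?lerDr sqr_ge0.
have e0 : 0 < pi / r by rewrite divr_gt0.
pose th (p : plane R) := x1 * p.1 + x2 * p.2 + t.
have thd p : th (p + d) = th p + pi.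
  by rewrite /th /= /q; field; rewrite gt_eqF.
have mth : measurable_fun setT th.
  apply: measurable_funD => //; apply: measurable_funD.
    by apply: measurable_funM.
  by apply: measurable_funM.
have [mc ms] := cmeas_expi mth.
rewrite (le_trans (cnorm_le_ReIm _))//=.
have -> : 2 * c * pi * a / Num.sqrt (x1 ^+ 2 + x2 ^+ 2) =
    c * a * (pi / r) + c * a * (pi / r) by rewrite -/q -/r; field; rewrite gt_eqF.
apply: lerD; apply: (hc a (pi / r) d) => //=; try exact: dle.
- by move=> p; rewrite ler_norml cos_geN1 cos_le1.
- by move=> p; change (cos (th (p + d)) = - cos (th p)); rewrite thd cosDpi.
- by move=> p; rewrite ler_norml sin_geN1 sin_le1.
- by move=> p; change (sin (th (p + d)) = - sin (th p)); rewrite thd sinDpi.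
Qed.

End ComplexIntegral.

(** * Approximation of matrices *)

Section MatrixNorm.
Variable R : realType.

(** The entrywise l1 norm: submultiplicative, unchanged by conjugation and transposition, comparable
    with [frob], and free of square roots. *)
Definition mxn (m n : nat) (A : 'M[R[i]]_(m, n)) : R :=
  \sum_(i < m) \sum_(j < n) cnorm (A i j).

Lemma mxn_ge0 m n (A : 'M[R[i]]_(m, n)) : 0 <= mxn A.
Proof. by do 2 apply: sumr_ge0 => ? _; exact: cnorm_ge0. Qed.

Lemma cnorm_le_mxn m n (A : 'M[R[i]]_(m, n)) i j : cnorm (A i j) <= mxn A.
Proof.
rewrite /mxn (bigD1 i)//= (bigD1 j)//= -addrA lerDl addr_ge0//.
  by apply: sumr_ge0 => ? _; exact: cnorm_ge0.
by do 2 apply: sumr_ge0 => ? _; exact: cnorm_ge0.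
Qed.

Lemma mxnD m n (A B : 'M[R[i]]_(m, n)) : mxn (A + B) <= mxn A + mxn B.
Proof.
rewrite /mxn -big_split /=; apply: ler_sum => i _.
by rewrite -big_split /=; apply: ler_sum => j _; rewrite mxE cnormD.
Qed.

Lemma mxnN m n (A : 'M[R[i]]_(m, n)) : mxn (- A) = mxn A.
Proof. by do 2 apply: eq_bigr => ? _; rewrite mxE cnormN. Qed.

Lemma mxnZ m n z (A : 'M[R[i]]_(m, n)) : mxn (z *: A) = cnorm z * mxn A.
Proof.
rewrite /mxn mulr_sumr; apply: eq_bigr => i _; rewrite mulr_sumr.
by apply: eq_bigr => j _; rewrite mxE cnormM.
Qed.

Lemma mxnM m n p (A : 'M[R[i]]_(m, n)) (B : 'M[R[i]]_(n, p)) :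
  mxn (A *m B) <= mxn A * mxn B.
Proof.
rewrite /mxn mulr_suml; apply: ler_sum => i _.
rewrite (@le_trans _ _ (\sum_(j < p) \sum_(k < n) cnorm (A i k) * cnorm (B k j)))//.
  apply: ler_sum => j _; rewrite mxE (le_trans (cnorm_sum _ _ _))//.
  by apply: ler_sum => k _; rewrite cnormM.
rewrite exchange_big /= mulr_suml; apply: ler_sum => k _.
rewrite -mulr_sumr ler_wpM2l ?cnorm_ge0//.
rewrite [leRHS](bigD1 k)//= lerDl.
by do 2 apply: sumr_ge0 => ? _; exact: cnorm_ge0.
Qed.

Lemma mxn_conj m n (A : 'M[R[i]]_(m, n)) : mxn (conj_mx A) = mxn A.
Proof. by do 2 apply: eq_bigr => ? _; rewrite mxE cnorm_conj. Qed.

Lemma mxn_tr m n (A : 'M[R[i]]_(m, n)) : mxn A^T = mxn A.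
Proof.
by rewrite /mxn exchange_big; do 2 apply: eq_bigr => ? _; rewrite mxE.
Qed.

Lemma mxn_cplx m n (A : 'M[R]_(m, n)) :
  mxn (cplx_mx A) = \sum_(i < m) \sum_(j < n) `|A i j|.
Proof. by do 2 apply: eq_bigr => ? _; rewrite mxE cnorm_real. Qed.

Lemma frob_le_mxn m n (A : 'M[R[i]]_(m, n)) : frob A <= mxn A.
Proof.
rewrite /frob -[leRHS]ger0_norm ?mxn_ge0// -sqrtr_sqr ler_wsqrtr//.
rewrite [leRHS]expr2 {1}/mxn mulr_suml; apply: ler_sum => i _.
rewrite mulr_suml; apply: ler_sum => j _.
by rewrite expr2 ler_wpM2l ?cnorm_ge0// cnorm_le_mxn.
Qed.

Lemma mxn_le_frob m n (A : 'M[R[i]]_(m, n)) : mxn A <= (m * n)%:R * frob A.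
Proof.
have entry i j : cnorm (A i j) <= frob A.
  rewrite -[leLHS]ger0_norm ?cnorm_ge0// -sqrtr_sqr ler_wsqrtr//.
  rewrite (bigD1 i)//= (bigD1 j)//= -addrA lerDl addr_ge0//.
    by apply: sumr_ge0 => ? _; exact: sqr_ge0.
  by do 2 apply: sumr_ge0 => ? _; exact: sqr_ge0.
rewrite (@le_trans _ _ (\sum_(i < m) \sum_(j < n) frob A))//.
  by do 2 apply: ler_sum => ? _.
by rewrite !sumr_const !card_ord -mulrnA mulr_natl mulnC.
Qed.

End MatrixNorm.

(* A = P + O(q), with a single constant bounding both P and the error. *)
Definition closem (R : realType) (q c : R) (m n : nat) (A P : 'M[R[i]]_(m, n)) : Prop :=
  mxn P <= c /\ mxn (A - P) <= c * q.

Definition closec (R : realType) (q c : R) (z w : R[i]) : Prop :=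
  cnorm w <= c /\ cnorm (z - w) <= c * q.

Section Closeness.
Variables (R : realType) (q : R).
Hypotheses (q0 : 0 <= q) (q1 : q <= 1).

Lemma closem_refl (c : R) m n (P : 'M[R[i]]_(m, n)) : mxn P <= c -> closem q c P P.
Proof.
move=> Pc; split=> //; rewrite subrr (_ : mxn 0 = 0) ?mulr_ge0//.
  exact: le_trans (mxn_ge0 P) Pc.
by rewrite /mxn big1// => i _; rewrite big1// => j _; rewrite mxE Normc.normc0.
Qed.

Lemma closem_ge0 c m n (A P : 'M[R[i]]_(m, n)) : closem q c A P -> 0 <= c.
Proof. by case=> + _; apply: le_trans; exact: mxn_ge0. Qed.

Lemma closem_norm c m n (A P : 'M[R[i]]_(m, n)) : closem q c A P -> mxn A <= 2 * c.
Proof.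
move=> h; have c0 := closem_ge0 h; case: h => h1 h2.
rewrite -(subrK P A) (le_trans (mxnD _ _))// mulr_natl mulr2n lerD//.
by rewrite (le_trans h2)// ler_piMr.
Qed.

Lemma closemD c d m n (A P B Q : 'M[R[i]]_(m, n)) :
  closem q c A P -> closem q d B Q -> closem q (c + d) (A + B) (P + Q).
Proof.
move=> [a1 a2] [b1 b2]; split.
  by rewrite (le_trans (mxnD _ _))// lerD.
by rewrite opprD addrACA mulrDl (le_trans (mxnD _ _))// lerD.
Qed.

Lemma closemN c m n (A P : 'M[R[i]]_(m, n)) : closem q c A P -> closem q c (- A) (- P).
Proof. by move=> [a1 a2]; split; rewrite -?opprD mxnN. Qed.

Lemma closem_conj c m n (A P : 'M[R[i]]_(m, n)) :
  closem q c A P -> closem q c (conj_mx A) (conj_mx P).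
Proof.
move=> [a1 a2]; split; rewrite ?mxn_conj//.
rewrite (_ : _ - _ = conj_mx (A - P)) ?mxn_conj//.
by apply/matrixP => i j; rewrite !mxE rmorphB.
Qed.

Lemma closem_tr c m n (A P : 'M[R[i]]_(m, n)) : closem q c A P -> closem q c A^T P^T.
Proof. by move=> [a1 a2]; split; rewrite -?linearB /= mxn_tr. Qed.

(** A B - P Q = (A - P) B + P (B - Q). Since q <= 1, B has norm at most 2 d, and the errors add up
    to (2 + 1) c d q. *)
Lemma closemM c d m n p (A P : 'M[R[i]]_(m, n)) (B Q : 'M[R[i]]_(n, p)) :
  closem q c A P -> closem q d B Q -> closem q (3 * c * d) (A *m B) (P *m Q).
Proof.
move=> hA hB; have c0 := closem_ge0 hA; have d0 := closem_ge0 hB.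
have nB := closem_norm hB; move: hA hB => [a1 a2] [b1 b2].
have cd0 : 0 <= c * d by rewrite mulr_ge0.
split.
  rewrite (le_trans (mxnM _ _))// (@le_trans _ _ (c * d))//.
    by rewrite ler_pM ?mxn_ge0.
  by rewrite -mulrA ler_peMl//; lra.
rewrite (_ : _ - _ = (A - P) *m B + P *m (B - Q)); last first.
  by rewrite mulmxBl mulmxBr addrA subrK.
rewrite (le_trans (mxnD _ _))//.
rewrite (_ : 3 * c * d * q = c * q * (2 * d) + c * (d * q)); last by ring.
by rewrite lerD// (le_trans (mxnM _ _))// ler_pM ?mxn_ge0.
Qed.

Lemma closem_scale c d m n z w (B Q : 'M[R[i]]_(m, n)) :
  closec q c z w -> closem q d B Q -> closem q (3 * c * d) (z *: B) (w *: Q).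
Proof.
move=> [a1 a2] hB; have d0 := closem_ge0 hB; have nB := closem_norm hB.
have c0 : 0 <= c by exact: le_trans (cnorm_ge0 w) a1.
move: hB => [b1 b2].
have cd0 : 0 <= c * d by rewrite mulr_ge0.
split.
  rewrite mxnZ (@le_trans _ _ (c * d))//.
    by rewrite ler_pM ?mxn_ge0 ?cnorm_ge0.
  by rewrite -mulrA ler_peMl//; lra.
rewrite (_ : _ - _ = (z - w) *: B + w *: (B - Q)); last first.
  by rewrite scalerBl scalerBr addrA subrK.
rewrite (le_trans (mxnD _ _))// !mxnZ.
rewrite (_ : 3 * c * d * q = c * q * (2 * d) + c * (d * q)); last by ring.
by rewrite lerD// ler_pM ?mxn_ge0 ?cnorm_ge0.
Qed.

(** Scalars are treated as 1 x 1 matrices, which reduces this to [closem_scale]. *)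
Lemma closecM c d (x y z w : R[i]) :
  closec q c x y -> closec q d z w -> closec q (3 * c * d) (x * z) (y * w).
Proof.
have E (u : R[i]) : mxn (u%:M : 'M[R[i]]_1) = cnorm u.
  by rewrite /mxn !big_ord1 mxE eqxx.
have toM (e : R) (u v : R[i]) : closec q e u v <-> closem q e (u%:M : 'M[R[i]]_1) v%:M.
  by rewrite /closem -raddfB /= !E.
move=> h1 /toM h2; apply/toM; rewrite !scalar_mxM !mul_scalar_mx.
exact: closem_scale.
Qed.

End Closeness.

(** * The amplitude of the Green function *)

Section EuclideanNorm.
Variables (R : realType) (n : nat).
Implicit Types u v : 'cV[R]_n.

Lemma enorm_ge0 v : 0 <= enorm v.
Proof. exact: sqrtr_ge0. Qed.

Lemma enorm_sqr v : enorm v ^+ 2 = \sum_(i < n) v i 0 ^+ 2.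
Proof. by rewrite sqr_sqrtr// sumr_ge0// => i _; exact: sqr_ge0. Qed.

Lemma coord_le_enorm v i : `|v i 0| <= enorm v.
Proof.
rewrite -sqrtr_sqr ler_wsqrtr// (bigD1 i)//= lerDl sumr_ge0// => j _.
exact: sqr_ge0.
Qed.

Lemma enormN v : enorm (- v) = enorm v.
Proof. by rewrite /enorm; under eq_bigr do rewrite mxE sqrrN. Qed.

(** The difference of squares |u|^2 - |v|^2 is the sum of the (u_i - v_i)(u_i + v_i), with |u_i +
    v_i| <= |u| + |v|; dividing by |u| + |v| gives the bound. *)
Lemma enorm_dist_le u v : `|enorm u - enorm v| <= \sum_(i < n) `|u i 0 - v i 0|.
Proof.
have [/eqP|uv0] := eqVneq (enorm u + enorm v) 0.
  rewrite paddr_eq0 ?enorm_ge0// => /andP[/eqP-> /eqP->].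
  by rewrite subrr normr0 sumr_ge0.
have uvp : 0 < enorm u + enorm v by rewrite lt0r uv0 addr_ge0 ?enorm_ge0.
rewrite -(ler_pM2r uvp) -[X in `|_| * X]gtr0_norm// -normrM -subr_sqr.
rewrite !enorm_sqr -sumrB mulr_suml (le_trans (ler_norm_sum _ _ _))//.
apply: ler_sum => i _; rewrite subr_sqr normrM ler_wpM2l//.
by rewrite (le_trans (ler_normD _ _))// lerD// coord_le_enorm.
Qed.

End EuclideanNorm.

Lemma sum_le_card (R : realType) n (F : 'I_n -> R) (e : R) :
  (forall i, F i <= e) -> \sum_(i < n) F i <= n%:R * e.
Proof.
move=> Fe; rewrite (le_trans (ler_sum _ (fun i _ => Fe i)))//.
by rewrite sumr_const card_ord mulr_natl.
Qed.

Definition kmat (R : realType) (k L : R) (u : 'cV[R]_3) : 'M[R[i]]_3 :=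
  let r := enorm u in let m := mfun_green (k * r) in
  (L / r)%:C%C *:
    ((1 + m) *: 1%:M - (1 + 3 * m) *: cplx_mx ((r ^+ 2)^-1 *: (u *m u^T))).

Lemma green_kmat (R : realType) (k L : R) (x y : 'cV[R]_3) : L != 0 ->
  green k x y = (expi (k * enorm (x - y)) * ((4 * pi * L)^-1)%:C%C) *: kmat k L (x - y).
Proof.
move=> L0; rewrite /green /kmat scalerA; congr (_ *: _).
rewrite -[RHS]mulrA -rmorphM /= -fmorphV; congr (_ * _%:C%C).
by rewrite !invfM -!mulrA mulKf.
Qed.

(* An orthogonal projection only when |v| = L. *)
Definition perp_proj (R : realType) (L : R) (v : 'cV[R]_3) : 'M[R[i]]_3 :=
  1%:M - cplx_mx ((L ^+ 2)^-1 *: (v *m v^T)).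

Lemma cplx_mxM (R : realType) m n p (A : 'M[R]_(m, n)) (B : 'M[R]_(n, p)) :
  cplx_mx (A *m B) = cplx_mx A *m cplx_mx B.
Proof. exact: map_mxM. Qed.

Lemma cplx_mxZ (R : realType) m n (c : R) (A : 'M[R]_(m, n)) :
  cplx_mx (c *: A) = c%:C%C *: cplx_mx A.
Proof. exact: map_mxZ. Qed.

Lemma mfun_green_le (R : realType) (s : R) : 0 < s ->
  cnorm (mfun_green s) <= s^-1 + (s^-1) ^+ 2.
Proof.
move=> s0; rewrite /mfun_green cnormM Normc.normcV.
have -> : cnorm (s%:C%C ^+ 2) = s ^+ 2.
  by rewrite -rmorphXn cnorm_real ger0_norm ?sqr_ge0.
have h : cnorm ('i%C * s%:C%C - 1) <= s + 1.
  rewrite (le_trans (cnormB _ _))// cnormM cnorm_real Normc.normc1 lerD2r.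
  by rewrite gtr0_norm//= expr0n add0r expr1n sqrtr1 mul1r.
rewrite ler_pdivrMr ?exprn_gt0// (le_trans h)// le_eqVlt; apply/orP; left.
by apply/eqP; field; rewrite gt_eqF.
Qed.

(** Moving v by at most kappa q L in each coordinate changes |v| / L = 1 and v / L by O(q), and (k
    r)^-1 = O(q) makes m(k r) = O(q). The amplitude is built from these by sums and products,
    through which closeness propagates. *)
Lemma kmat_close (R : realType) (kappa : R) : exists C : R,
  forall (q k L : R) (u v : 'cV[R]_3), 0 < q -> q <= 1 -> 1 <= kappa ->
  6 * kappa * q <= 1 -> 0 < k -> 0 < L -> (k * L)^-1 <= q ^+ 2 ->
  enorm v = L -> (forall i, `|u i 0 - v i 0| <= kappa * q * L) ->
  closem q C (kmat k L u) (perp_proj L v).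
Proof.
(* The constant is left open and assembled by unification with the closeness lemmas at the end.
   Being created before the parameters, it can depend on [kappa] only. *)
eexists => q k L u v q0 q1 k1 kq k0 L0 kL vL uv.
have kap0 : 0 <= kappa by exact: le_trans ler01 k1.
have q0' := ltW q0.
have kq0 : 0 <= kappa * q by rewrite mulr_ge0.
have Ln0 : L != 0 by rewrite gt_eqF.
pose rho := enorm u / L.
have rho1 : `|rho - 1| <= 3 * kappa * q.
  have -> : rho - 1 = (enorm u - L) / L by rewrite /rho; field.
  rewrite normrM normfV (gtr0_norm L0) ler_pdivrMr//.
  rewrite -{1}vL (le_trans (enorm_dist_le _ _))//.
  by rewrite (le_trans (sum_le_card uv))// -!mulrA.
(* This is where 6 kappa q <= 1 enters: rho differs from 1 by at most 1 / 2, so its inverse is at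
   most 2. *)
have rhoge : 1 / 2 <= rho by move: rho1; rewrite ler_norml => /andP[? ?]; lra.
have rho0 : 0 < rho by lra.
have rhon0 : rho != 0 by rewrite gt_eqF.
have uE : enorm u = rho * L by rewrite /rho divfK.
have rhoE : L / enorm u = rho^-1 by rewrite /rho invf_div.
clearbody rho.
have invrho : rho^-1 <= 2 by rewrite -[leRHS]invrK lef_pV2 ?posrE//; lra.
have invrho1 : `|rho^-1 - 1| <= 6 * kappa * q.
  have -> : rho^-1 - 1 = (1 - rho) * rho^-1 by field.
  rewrite normrM distrC (ger0_norm (ltW _)) ?invr_gt0//.
  have := ler_pM (normr_ge0 _) (ltW _) rho1 invrho; rewrite invr_gt0 => /(_ rho0).
  lra.
have cl_inv : closec q (6 * kappa) (rho^-1)%:C%C 1.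
  split; first by rewrite Normc.normc1; lra.
  by rewrite -(rmorph1 (real_complex R)) -rmorphB cnorm_real.
have cl_inv2 := closecM q1 cl_inv cl_inv.
have kr : (k * enorm u)^-1 <= 2 * q.
  have -> : (k * enorm u)^-1 = rho^-1 * (k * L)^-1.
    by rewrite uE; field; rewrite rhon0 Ln0 gt_eqF.
  have kL0 : 0 <= (k * L)^-1 by rewrite invr_ge0 ltW// mulr_gt0.
  have rv0 : 0 <= rho^-1 by rewrite invr_ge0 ltW.
  rewrite (le_trans (ler_pM rv0 kL0 invrho kL))// ler_wpM2l//.
  by rewrite expr2 ler_piMl.
have kr0 : 0 <= (k * enorm u)^-1 by rewrite invr_ge0 mulr_ge0 ?enorm_ge0// ltW.
have ms : cnorm (mfun_green (k * enorm u)) <= 6 * q.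
  have kr1 : 0 < k * enorm u by rewrite uE !mulr_gt0.
  rewrite (le_trans (mfun_green_le kr1))//.
  have : ((k * enorm u)^-1) ^+ 2 <= 4 * q.
    rewrite expr2 (le_trans (ler_pM _ _ kr kr))//.
    by rewrite (_ : 2 * q * (2 * q) = 4 * q * q); [rewrite ler_piMr ?mulr_ge0|ring].
  lra.
have cl_m1 : closec q 6 (1 + mfun_green (k * enorm u)) 1.
  by split; [rewrite Normc.normc1; lra|rewrite addrAC subrr add0r].
have cl_m3 : closec q 18 (1 + 3 * mfun_green (k * enorm u)) 1.
  split; first by rewrite Normc.normc1; lra.
  rewrite addrAC subrr add0r cnormM.
  have -> : cnorm (3 : R[i]) = 3.
    by rewrite -(rmorph_nat (real_complex R) 3) cnorm_real ger0_norm.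
  lra.
have sumle (w : 'cV[R]_3) (e : R) : (forall i, `|w i 0| <= e) -> mxn (cplx_mx w) <= 3 * e.
  by move=> we; rewrite mxn_cplx sum_le_card// => i; rewrite big_ord1.
have cl_u : closem q (3 * kappa) (cplx_mx (L^-1 *: u)) (cplx_mx (L^-1 *: v)).
  split.
    rewrite (le_trans (sumle _ 1 _)) ?mulr1 ?ler_peMr// => i.
    rewrite mxE normrM normfV (gtr0_norm L0) mulrC ler_pdivrMr// mul1r.
    by rewrite -vL coord_le_enorm.
  rewrite -raddfB -scalerBr -mulrA sumle// => i.
  rewrite !mxE normrM normfV (gtr0_norm L0) mulrC ler_pdivrMr//.
have -> : kmat k L u = (rho^-1)%:C%C *: ((1 + mfun_green (k * enorm u)) *: 1%:M +
    - ((1 + 3 * mfun_green (k * enorm u)) *: (((rho^-1)%:C%C * (rho^-1)%:C%C) *: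
       (cplx_mx (L^-1 *: u) *m (cplx_mx (L^-1 *: u))^T)))).
  rewrite /kmat rhoE; congr (_ *: (_ - _ *: _)).
  rewrite /cplx_mx map_trmx -/(cplx_mx _) -!cplx_mxM -rmorphM -cplx_mxZ.
  congr cplx_mx; rewrite linearZ /= -scalemxAl -scalemxAr !scalerA.
  by congr (_ *: _); rewrite uE; field; rewrite Ln0.
(* Unit factors are inserted so that the limit has the same tree of operations as the amplitude; the
   closeness lemmas then apply node by node. *)
have -> : perp_proj L v = 1 *: (1 *: 1%:M + - (1 *: ((1 * 1) *:
    (cplx_mx (L^-1 *: v) *m (cplx_mx (L^-1 *: v))^T)))).
  rewrite mulr1 !scale1r /perp_proj; congr (_ - _).
  rewrite /cplx_mx map_trmx -/(cplx_mx _) -!cplx_mxM.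
  congr cplx_mx; rewrite linearZ /= -scalemxAl -scalemxAr !scalerA.
  by congr (_ *: _); field.
apply: (closem_scale q1 cl_inv); apply: closemD.
  apply: (closem_scale q1 cl_m1); apply: (closem_refl q0').
  exact: lexx.
apply: closemN; apply: (closem_scale q1 cl_m3).
apply: (closem_scale q1 cl_inv2); apply: (closemM q1 cl_u).
exact: (closem_tr cl_u).
Qed.

(** * Expansion of the phase *)

(* The consequences of the Fraunhofer regime that hold from some index on. *)
Record regime (R : realType) (k L a b h M eps : R) : Prop := Regime {
  regime_k : 0 < k;
  regime_L : 0 < L;
  regime_a : 0 < a;
  regime_b : 0 < b;
  regime_h : 0 < h;
  regime_kh : k * h <= M;
  regime_eps : a / L <= eps;
  regime_Theta_a : 1 <= Theta k L a;
  regime_Theta_b : Theta k L b <= 1;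
  regime_Theta_a_up : a ^+ 2 * Theta k L a / L ^+ 2 <= 1
}.

Section Regime.
Variables (R : realType) (k L a b h M eps : R).
Hypothesis hreg : regime k L a b h M eps.
Local Notation q := (a / L).
Local Notation tau := (a ^+ 2 * Theta k L a / L ^+ 2).

Let k0 := regime_k hreg.
Let L0 := regime_L hreg.
Let a0 := regime_a hreg.
Let b0 := regime_b hreg.
Let h0 := regime_h hreg.

Lemma regime_M : 0 < M.
Proof. by apply: lt_le_trans (regime_kh hreg); rewrite mulr_gt0. Qed.

Lemma regime_q : 0 < q.
Proof. by rewrite divr_gt0. Qed.

Lemma regime_ba : b <= a.
Proof.
have := le_trans (regime_Theta_b hreg) (regime_Theta_a hreg).
rewrite /Theta ler_pM2r ?invr_gt0// ler_pM2l//.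
by rewrite ler_sqr ?nnegrE ?(ltW a0) ?(ltW b0).
Qed.

(** A rewriting of Theta_a >= 1, since k L (a/L)^2 = Theta_a. *)
Lemma regime_kL : (k * L)^-1 <= q ^+ 2.
Proof.
have := regime_Theta_a hreg; rewrite /Theta ler_pdivlMr// mul1r => h1.
rewrite exprMn exprVn -(ler_pM2l (mulr_gt0 k0 L0)) divff ?gt_eqF ?mulr_gt0//.
have -> : k * L * (a ^+ 2 / L ^+ 2) = k * a ^+ 2 / L by field; rewrite gt_eqF.
by rewrite ler_pdivlMr// mul1r.
Qed.

(** Write h = (k h) (k L)^-1 L and bound the factors by M and (a/L)^2. *)
Lemma regime_hL : h <= M * q * a.
Proof.
have h1 : h = (k * h) * (k * L)^-1 * L by field; rewrite !gt_eqF.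
have kL0 : 0 <= (k * L)^-1 by rewrite invr_ge0 ltW// mulr_gt0.
rewrite h1 (_ : M * q * a = M * q ^+ 2 * L); last by field; rewrite gt_eqF.
rewrite ler_wpM2r ?(ltW L0)//.
by apply: ler_pM; rewrite ?(regime_kh hreg) ?regime_kL// ltW// mulr_gt0.
Qed.

Lemma regime_q2_tau : q ^+ 2 <= tau.
Proof.
rewrite mulrAC -exprVn -exprMn ler_peMr ?(regime_Theta_a hreg)//.
exact: sqr_ge0.
Qed.

Lemma tauE : tau = k * a ^+ 4 / L ^+ 3.
Proof. by rewrite /Theta; field; rewrite gt_eqF. Qed.

(** Here r and s are the distances from the receiver x to two points with cross-range coordinates y,
    z and range offsets e, f. With S = r + s, S (s - r) = s^2 - r^2 is polynomial and free of |x|^2.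
    Hence S times the error T consists of |z|^2 - |y|^2, the source of Theta_b, and of terms with a
    factor close to S - 2 L = O(a^2 / L + h), which produce a^2 Theta_a / L^2. Dividing by S >= L
    concludes. *)
Lemma phase_expansion (c x1 x2 y1 y2 e z1 z2 f r s : R) :
  1 <= c -> c * M * eps ^+ 2 <= 1 / 2 ->
  `|x1| <= c * a -> `|x2| <= c * a ->
  `|y1| <= c * b -> `|y2| <= c * b -> `|e| <= c * h ->
  `|z1| <= c * b -> `|z2| <= c * b -> `|f| <= c * h ->
  0 <= r -> r ^+ 2 = (x1 - y1) ^+ 2 + (x2 - y2) ^+ 2 + (L + e) ^+ 2 ->
  0 <= s -> s ^+ 2 = (x1 - z1) ^+ 2 + (x2 - z2) ^+ 2 + (L + f) ^+ 2 ->
  `|k * (s - r) - (k * (f - e) - k / L * (x1 * (z1 - y1) + x2 * (z2 - y2)))|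
    <= (104 * c ^+ 4 * (1 + M)) * (tau + Theta k L b).
Proof.
move=> c1 ceps hx1 hx2 hy1 hy2 he hz1 hz2 hf r0 rE s0 sE.
have c0 : 0 < c by exact: lt_le_trans c1.
have M0 := regime_M; have ba := regime_ba; have q0 := regime_q.
(* By h <= M q a, c h <= c M q^2 L <= L / 2. Then L + e and L + f are at least L / 2, so r + s >=
   L. *)
have chL : c * h <= L / 2.
  rewrite (le_trans (ler_wpM2l (ltW c0) regime_hL))//.
  have -> : c * (M * q * a) = c * M * q ^+ 2 * L by field; rewrite gt_eqF.
  rewrite mulrC ler_pM2l// (le_trans _ (le_trans ceps _))//; last lra.
  rewrite ler_wpM2l ?mulr_ge0 ?(ltW c0) ?(ltW M0)// ler_sqr ?nnegrE ?(regime_eps hreg) ?(ltW q0)//.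
  exact: le_trans (ltW q0) (regime_eps hreg).
have cb0 : 0 <= c * b by rewrite mulr_ge0 ?ltW.
have cba : c * b <= c * a by rewrite ler_pM2l.
have ca0 : 0 <= c * a by rewrite mulr_ge0 ?ltW.
(* a single distance exceeds its vertical part by O(a^2 / L) *)
have dist (y1' y2' e' r' : R) : `|y1'| <= c * b -> `|y2'| <= c * b -> `|e'| <= c * h ->
    0 <= r' -> r' ^+ 2 = (x1 - y1') ^+ 2 + (x2 - y2') ^+ 2 + (L + e') ^+ 2 ->
    L / 2 <= r' /\ 0 <= r' - (L + e') <= 8 * (c * a) ^+ 2 / L.
  move=> h1 h2 h3 r'0 r'E.
  have Le : L / 2 <= L + e' by move: h3; rewrite ler_norml => /andP[? ?]; lra.
  have sq (x y : R) : `|x| <= c * a -> `|y| <= c * b -> (x - y) ^+ 2 <= 4 * (c * a) ^+ 2.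
    move=> hx hy; have -> : 4 * (c * a) ^+ 2 = (2 * (c * a)) ^+ 2 by ring.
    have ca2 : 0 <= 2 * (c * a) by rewrite mulr_ge0.
    rewrite -real_normK ?num_real// ler_sqr ?nnegrE//.
    by rewrite (le_trans (ler_normB _ _))//; lra.
  have [s1 s2] := (sq _ _ hx1 h1, sq _ _ hx2 h2).
  have n1 := sqr_ge0 (x1 - y1'); have n2 := sqr_ge0 (x2 - y2').
  have Le0 : 0 <= L + e' by apply: le_trans Le; rewrite divr_ge0// ltW.
  have Ler : L + e' <= r' by rewrite -ler_sqr ?nnegrE//; lra.
  split; first exact: le_trans Le Ler.
  rewrite subr_ge0 Ler /= ler_pdivlMr//.
  apply: (@le_trans _ _ ((r' - (L + e')) * (r' + (L + e')))).
    by rewrite ler_wpM2l ?subr_ge0//; lra.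
  by rewrite -subr_sqr r'E; lra.
have [rL /andP[r1 r2]] := dist _ _ _ _ hy1 hy2 he r0 rE.
have [sL /andP[s1 s2]] := dist _ _ _ _ hz1 hz2 hf s0 sE.
pose S := r + s; have SL : L <= S by rewrite /S; lra.
have S0 : 0 < S by exact: lt_le_trans SL.
set X := x1 * (z1 - y1) + x2 * (z2 - y2).
pose T := s - r - (f - e) + X / L.
have -> : k * (s - r) - (k * (f - e) - k / L * X) = k * T.
  by rewrite /T; field; rewrite gt_eqF.
have ST : S * T = (z1 ^+ 2 + z2 ^+ 2 - (y1 ^+ 2 + y2 ^+ 2)) +
    (2 * L + e + f - S) * (f - e) + (S - 2 * L) * X / L.
  have Sd : S * (s - r) = s ^+ 2 - r ^+ 2 by rewrite /S; ring.
  rewrite {1}/T mulrDr mulrBr Sd sE rE /X; field.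
  by rewrite gt_eqF.
pose D := 8 * (c * a) ^+ 2 / L.
have Xle : `|X| <= 4 * (c * a) * (c * b).
  have part (x y z : R) : `|x| <= c * a -> `|y| <= c * b -> `|z| <= c * b ->
      `|x * (z - y)| <= (c * a) * (2 * (c * b)).
    move=> ? hy hz; rewrite normrM ler_pM//.
    by rewrite (le_trans (ler_normB _ _))//; lra.
  rewrite (le_trans (ler_normD _ _))//.
  by have := part _ _ _ hx1 hy1 hz1; have := part _ _ _ hx2 hy2 hz2; lra.
have t1 : `|z1 ^+ 2 + z2 ^+ 2 - (y1 ^+ 2 + y2 ^+ 2)| <= 2 * (c * b) ^+ 2.
  have sq (x : R) : `|x| <= c * b -> 0 <= x ^+ 2 <= (c * b) ^+ 2.
    by move=> hx; rewrite sqr_ge0 -real_normK ?num_real// ler_sqr ?nnegrE.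
  move: (sq _ hy1) (sq _ hy2) (sq _ hz1) (sq _ hz2).
  move=> /andP[? ?] /andP[? ?] /andP[? ?] /andP[? ?].
  by rewrite ler_norml; apply/andP; split; lra.
have ef : `|f - e| <= 2 * (c * h) by rewrite (le_trans (ler_normB _ _))//; lra.
have t2 : `|(2 * L + e + f - S) * (f - e)| <= (2 * D) * (2 * (c * h)).
  rewrite normrM ler_pM// ler_norml /D /S; apply/andP; split; lra.
have SL2 : `|S - 2 * L| <= 2 * D + 2 * (c * h).
  move: he hf; rewrite !ler_norml => /andP[? ?] /andP[? ?].
  by apply/andP; rewrite /D /S; split; lra.
have t3 : `|(S - 2 * L) * X / L| <=
    (2 * D + 2 * (c * h)) * (4 * (c * a) * (c * b)) / L.
  rewrite 2!normrM normfV (gtr0_norm L0) ler_pM2r ?invr_gt0//.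
  by rewrite ler_pM.
have total : L * `|T| <= 2 * (c * b) ^+ 2 + (2 * D) * (2 * (c * h)) +
    (2 * D + 2 * (c * h)) * (4 * (c * a) * (c * b)) / L.
  rewrite (@le_trans _ _ (S * `|T|))// ?ler_wpM2r//.
  rewrite -{1}(gtr0_norm S0) -normrM ST.
  by rewrite (le_trans (ler_normD _ _))// lerD// (le_trans (ler_normD _ _))// lerD.
rewrite normrM (gtr0_norm k0).
have : k * `|T| <= k / L * (2 * (c * b) ^+ 2 + (2 * D) * (2 * (c * h)) +
    (2 * D + 2 * (c * h)) * (4 * (c * a) * (c * b)) / L).
  have -> : k * `|T| = k / L * (L * `|T|) by field; rewrite gt_eqF.
  exact: (ler_wpM2l (ltW (divr_gt0 k0 L0)) total).
have -> : k / L * (2 * (c * b) ^+ 2 + 2 * D * (2 * (c * h)) +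
    (2 * D + 2 * (c * h)) * (4 * (c * a) * (c * b)) / L) =
    2 * c ^+ 2 * Theta k L b + 32 * c ^+ 3 * ((k * h) * q ^+ 2) +
    64 * c ^+ 4 * (k * a ^+ 3 * b / L ^+ 3) + 8 * c ^+ 3 * ((k * h) * (q * (b / L))).
  by rewrite /D /Theta; field; rewrite gt_eqF.
move/le_trans; apply.
have tau0 : 0 <= tau by apply: le_trans regime_q2_tau; exact: sqr_ge0.
have TB0 : 0 <= Theta k L b.
  by rewrite /Theta divr_ge0 ?mulr_ge0 ?sqr_ge0 ?ltW.
have kh0 : 0 <= k * h by rewrite mulr_ge0 ?ltW.
have u1 : (k * h) * q ^+ 2 <= M * tau.
  by rewrite ler_pM ?sqr_ge0 ?(regime_kh hreg) ?regime_q2_tau.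
have qb0 : 0 <= q * (b / L).
  by rewrite mulr_ge0 ?(ltW q0)// divr_ge0 ?(ltW b0) ?(ltW L0).
have u2 : (k * h) * (q * (b / L)) <= M * tau.
  have qb : q * (b / L) <= q ^+ 2.
    by rewrite expr2 ler_pM2l// ler_pM2r ?invr_gt0.
  rewrite ler_pM ?(regime_kh hreg)//.
  exact: le_trans qb regime_q2_tau.
have u3 : k * a ^+ 3 * b / L ^+ 3 <= tau.
  rewrite tauE ler_pM2r ?invr_gt0 ?exprn_gt0//.
  have -> : k * a ^+ 4 = k * a ^+ 3 * a by ring.
  by rewrite ler_pM2l// mulr_gt0// exprn_gt0.
have c24 : c ^+ 2 <= c ^+ 4 by rewrite ler_weXn2l.
have c34 : c ^+ 3 <= c ^+ 4 by rewrite ler_weXn2l.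
have c30 : 0 <= c ^+ 3 by rewrite exprn_ge0// ltW.
have c40 : 0 <= c ^+ 4 by rewrite exprn_ge0// ltW.
have Mtau : 0 <= M * tau by rewrite mulr_ge0// ltW.
have MTB : 0 <= M * Theta k L b by rewrite mulr_ge0// ltW.
have v1 : c ^+ 2 * Theta k L b <= c ^+ 4 * Theta k L b by rewrite ler_wpM2r.
have v2 : c ^+ 3 * ((k * h) * q ^+ 2) <= c ^+ 4 * (M * tau).
  by rewrite ler_pM// mulr_ge0// sqr_ge0.
have v3 : c ^+ 4 * (k * a ^+ 3 * b / L ^+ 3) <= c ^+ 4 * tau by rewrite ler_wpM2l.
have v4 : c ^+ 3 * ((k * h) * (q * (b / L))) <= c ^+ 4 * (M * tau).
  by rewrite ler_pM// mulr_ge0.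
have w1 : 0 <= c ^+ 4 * tau by rewrite mulr_ge0.
have w2 : 0 <= c ^+ 4 * Theta k L b by rewrite mulr_ge0.
have w3 : 0 <= c ^+ 4 * (M * tau) by rewrite mulr_ge0.
have w4 : 0 <= c ^+ 4 * (M * Theta k L b) by rewrite mulr_ge0.
(* The coefficients found are 2 on Theta_b, 64 on tau, and 32 + 8 on M tau; 104 = 64 + 32 + 8
   dominates each of them. *)
have -> : 104 * c ^+ 4 * (1 + M) * (tau + Theta k L b) =
  104 * (c ^+ 4 * tau + c ^+ 4 * Theta k L b + c ^+ 4 * (M * tau) +
         c ^+ 4 * (M * Theta k L b)) by ring.
rewrite -!(mulrA _ (c ^+ _)).
move: v1 v2 v3 v4 w1 w2 w3 w4.
move: (c ^+ 4 * tau) (c ^+ 4 * Theta k L b) (c ^+ 4 * (M * tau)) (c ^+ 4 * (M * Theta k L b)).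
by move=> A1 A2 A3 A4; lra.
Qed.

End Regime.

(** * Contribution of one dipole *)

Section MatrixIntegral.
Variable R : realType.

Definition mmeas (m n : nat) (F : plane R -> 'M[R[i]]_(m, n)) : Prop :=
  forall i j, cmeas (fun p => F p i j).

Lemma mmeas_cst m n (B : 'M[R[i]]_(m, n)) : mmeas (fun=> B).
Proof. by move=> i j; exact: cmeas_cst. Qed.

Lemma mmeas_scale m n (f : plane R -> R[i]) (F : plane R -> 'M[R[i]]_(m, n)) :
  cmeas f -> mmeas F -> mmeas (fun p => f p *: F p).
Proof.
move=> mf mF i j; rewrite (_ : (fun p => _) = (fun p => f p * F p i j)).
  exact: cmeasM.
by apply/funext => p; rewrite mxE.
Qed.

Lemma mmeasB m n (F G : plane R -> 'M[R[i]]_(m, n)) :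
  mmeas F -> mmeas G -> mmeas (fun p => F p - G p).
Proof.
move=> mF mG i j; rewrite (_ : (fun p => _) = (fun p => F p i j - G p i j)).
  exact: cmeasB.
by apply/funext => p; rewrite !mxE.
Qed.

Lemma mmeasM m n l (F : plane R -> 'M[R[i]]_(m, n)) (G : plane R -> 'M[R[i]]_(n, l)) :
  mmeas F -> mmeas G -> mmeas (fun p => F p *m G p).
Proof.
move=> mF mG i j.
rewrite (_ : (fun p => _) = (fun p => \sum_k F p i k * G p k j)).
  by apply: cmeas_sum => k; exact: cmeasM.
by apply/funext => p; rewrite mxE.
Qed.

Lemma mmeas_conj m n (F : plane R -> 'M[R[i]]_(m, n)) :
  mmeas F -> mmeas (fun p => conj_mx (F p)).
Proof.
move=> mF i j; rewrite (_ : (fun p => _) = (fun p => (F p i j)^*%C)).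
  exact: cmeas_conj.
by apply/funext => p; rewrite mxE.
Qed.

Definition mbounded (m n : nat) (A : set (R * R)) (F : plane R -> 'M[R[i]]_(m, n)) : Prop :=
  mmeas F /\ exists c, forall p, A p -> mxn (F p) <= c.

Lemma mbounded_entry m n A (F : plane R -> 'M[R[i]]_(m, n)) i j :
  mbounded A F -> cbounded A (fun p => F p i j).
Proof.
by move=> [mF [c hc]]; split => //; exists c => p /hc; apply: le_trans; exact: cnorm_le_mxn.
Qed.

Section OnSet.
Variables (A : set (plane R)) (mA : measurable A) (fA : (area_measure R A < +oo)%E).

Lemma mx_integralD m n (F G : plane R -> 'M[R[i]]_(m, n)) :
  mbounded A F -> mbounded A G ->
  mx_integral A (fun p => F p + G p) = mx_integral A F + mx_integral A G.
Proof.
move=> bF bG; apply/matrixP => i j; rewrite !mxE.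
transitivity (cint A (fun p => F p i j + G p i j)).
  by congr cint; apply/funext => p; rewrite mxE.
by rewrite cintD//; exact: mbounded_entry.
Qed.

Lemma mx_integralZ m n z (F : plane R -> 'M[R[i]]_(m, n)) :
  mbounded A F -> mx_integral A (fun p => z *: F p) = z *: mx_integral A F.
Proof.
move=> bF; apply/matrixP => i j; rewrite !mxE.
transitivity (cint A (fun p => z * F p i j)).
  by congr cint; apply/funext => p; rewrite mxE.
by rewrite cintZ//; exact: mbounded_entry.
Qed.

Lemma mx_integral_cst m n (f : plane R -> R[i]) (B : 'M[R[i]]_(m, n)) :
  cbounded A f -> mx_integral A (fun p => f p *: B) = cint A f *: B.
Proof.
move=> bf; apply/matrixP => i j; rewrite !mxE.
transitivity (cint A (fun p => B i j * f p)).
  by congr cint; apply/funext => p; rewrite mxE mulrC.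
by rewrite cintZ// mulrC.
Qed.

Lemma mx_integral_sum m n (I : Type) (r : seq I) (F : I -> plane R -> 'M[R[i]]_(m, n)) :
  (forall i, mbounded A (F i)) ->
  mx_integral A (fun p => \sum_(i <- r) F i p) = \sum_(i <- r) mx_integral A (F i).
Proof.
move=> bF; apply/matrixP => i j; rewrite summxE mxE.
transitivity (cint A (fun p => \sum_(l <- r) F l p i j)).
  by congr cint; apply/funext => p; rewrite summxE.
rewrite cint_sum//; last by move=> l; exact: mbounded_entry.
by apply: eq_bigr => l _; rewrite mxE.
Qed.

Lemma mxn_mx_integral_le m n (F : plane R -> 'M[R[i]]_(m, n)) c :
  mmeas F -> (forall p, A p -> mxn (F p) <= c) ->
  mxn (mx_integral A F) <= (m * n)%:R * (2 * c * mes A).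
Proof.
move=> mF hc.
rewrite (@le_trans _ _ (\sum_(i < m) \sum_(j < n) 2 * c * mes A))//.
  apply: ler_sum => i _; apply: ler_sum => j _; rewrite mxE.
  apply: (@cnorm_cint_le _ _ mA fA (fun p => F p i j)) => // p Ap.
  by rewrite (le_trans (cnorm_le_mxn _ _ _))// hc.
by rewrite !sumr_const !card_ord -mulrnA [leRHS]mulr_natl mulnC.
Qed.

End OnSet.
End MatrixIntegral.

(** * Measurability of the amplitude in the receiver position *)

Section GreenMeasurable.
Variable R : realType.

(** Inversion is not continuous at 0. On nonnegative reals it agrees with the power of exponent -1,
    which is measurable; at 0 both are 0. *)
Lemma measurable_inv_ge0 (r : plane R -> R) : (forall p, 0 <= r p) ->
  measurable_fun setT r -> measurable_fun setT (fun p => (r p)^-1).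
Proof.
move=> r0 mr; rewrite (_ : (fun p => _) = (fun p => r p `^ (-1))).
  have mp : measurable_fun [set: R] (fun x : R => x `^ (-1)).
    exact: (@measurable_powR R).
  exact: (measurableT_comp mp mr).
by apply/funext => p; rewrite powR_inv1.
Qed.

Lemma measurable_in_plane (y : 'cV[R]_3) i :
  measurable_fun setT (fun p : plane R => (in_plane p - y) i 0).
Proof.
rewrite (_ : (fun p => _) = (fun p : plane R => [:: p.1; p.2; 0]`_i - y i 0)).
  apply: measurable_funB; last exact: measurable_cst.
  by case: i => -[|[|[|i]]] //= lti; [exact: measurable_fst|exact: measurable_snd].
by apply/funext => p; rewrite !mxE.
Qed.

Lemma measurable_enorm_in_plane (y : 'cV[R]_3) :
  measurable_fun setT (fun p : plane R => enorm (in_plane p - y)).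
Proof.
rewrite /enorm; apply: (measurableT_comp (f := @Num.sqrt R)).
  by apply: continuous_measurable_fun; exact: sqrt_continuous.
by apply: measurable_sum => i; apply: measurable_funX; exact: measurable_in_plane.
Qed.

Lemma cmeas_mfun_green (k : R) (r : plane R -> R) : 
  measurable_fun setT r -> cmeas (fun p => mfun_green (k * r p)).
Proof.
move=> mr; have ms : measurable_fun setT (fun p => k * r p).
  by apply: measurable_funM => //; exact: measurable_cst.
rewrite /mfun_green; apply: cmeasM.
  apply: cmeasB; last exact: cmeas_cst.
  by apply: cmeasM; [exact: cmeas_cst|exact: cmeas_real].
rewrite (_ : (fun p => _) = (fun p => (((k * r p) ^+ 2)^-1)%:C%C)).
  apply: cmeas_real; apply: measurable_inv_ge0; first by move=> p; exact: sqr_ge0.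
  exact: measurable_funX.
by apply/funext => p; rewrite -rmorphXn -fmorphV.
Qed.

Lemma mmeas_kmat (k L : R) (y : 'cV[R]_3) :
  mmeas (fun p : plane R => kmat k L (in_plane p - y)).
Proof.
have mr := measurable_enorm_in_plane y.
have r0 (p : plane R) : 0 <= enorm (in_plane p - y) := enorm_ge0 _.
have mm := cmeas_mfun_green k mr.
rewrite /kmat; apply: mmeas_scale.
  apply: cmeas_real; apply: measurable_funM; first exact: measurable_cst.
  exact: measurable_inv_ge0.
apply: mmeasB; apply: mmeas_scale.
- by apply: cmeasD => //; exact: cmeas_cst.
- exact: mmeas_cst.
- by apply: cmeasD; [exact: cmeas_cst|apply: cmeasM => //; exact: cmeas_cst].
move=> i j.
rewrite (_ : (fun p => _) = (fun p => ((enorm (in_plane p - y) ^+ 2)^-1 *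
   ((in_plane p - y) i 0 * (in_plane p - y) j 0))%:C%C)).
  apply: cmeas_real; apply: measurable_funM.
    apply: measurable_inv_ge0; first by move=> p; exact: sqr_ge0.
    exact: measurable_funX.
  by apply: measurable_funM; exact: measurable_in_plane.
by apply/funext => p; rewrite mxE mxE mxE big_ord1 [X in _ * (_ * X)]mxE.
Qed.

End GreenMeasurable.

(** * The complex exponential of a real phase *)

Section Expi.
Variable R : realType.
Implicit Types s t : R.

Lemma expiD s t : expi (s + t) = expi s * expi t.
Proof.
by rewrite /expi [RHS]/GRing.mul /= cosD sinD; congr Complex; rewrite addrC mulrC addrC.
Qed.

Lemma conj_expi t : ((expi t)^*)%C = expi (- t).
Proof. by rewrite /expi /= cosN sinN. Qed.

Lemma expi0 : expi 0 = 1 :> R[i].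
Proof. by rewrite /expi cos0 sin0. Qed.

Lemma cnorm_expi t : cnorm (expi t) = 1.
Proof. by rewrite /= cos2Dsin2 sqrtr1. Qed.

Lemma le_1_lipschitz (f df : R -> R) :
  (forall x : R, is_derive x (1 : R) f (df x)) -> (forall x, `|df x| <= 1) ->
  forall s t, `|f s - f t| <= `|s - t|.
Proof.
move=> dfE df1.
have key s t : s <= t -> `|f t - f s| <= `|t - s|.
  move=> st; have cf : {within `[s, t], continuous f}.
    by apply: derivable_within_continuous => x _; exact: ex_derive.
  have [x _ ->] := MVT_segment st (fun x _ => dfE x) cf.
  by rewrite normrM ler_piMl.
move=> s t; have [st|/ltW ts] := leP s t; last exact: key.
by rewrite distrC (distrC s); exact: key.
Qed.

Lemma expi_lipschitz s t : cnorm (expi s - expi t) <= 2 * `|s - t|.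
Proof.
rewrite (le_trans (cnorm_le_ReIm _))//= mulr_natl mulr2n lerD//.
  apply: (@le_1_lipschitz cos (fun x => - sin x)) => x.
  by rewrite normrN ler_norml sin_geN1 sin_le1.
apply: (@le_1_lipschitz sin cos) => x.
by rewrite ler_norml cos_geN1 cos_le1.
Qed.

End Expi.

Section PairTerm.
Variable R : realType.
Implicit Types (k L : R) (xs y z : 'cV[R]_3) (al : 'M[R[i]]_3) (p : plane R).

Definition pair_term k xs y z al p : 'M[R[i]]_3 :=
  conj_mx (green k (in_plane p) y)
    *m (green k (in_plane p) z *m al *m green k z xs)
    *m conj_mx (green k xs y).

Definition pair_amplitude k L xs y z al p : 'M[R[i]]_3 :=
  conj_mx (kmat k L (in_plane p - y))
    *m (kmat k L (in_plane p - z) *m al *m kmat k L (z - xs))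
    *m conj_mx (kmat k L (xs - y)).

(** Conjugated legs count negatively. The receiver occurs only in the first difference; the source
    legs add a constant, which leaves the modulus of the integral unchanged. *)
Definition pair_phase k xs y z p : R :=
  k * (enorm (in_plane p - z) - enorm (in_plane p - y))
  + k * (enorm (z - xs) - enorm (xs - y)).

(** The inner projections come from the data and the outer ones from back-propagation. They are kept
    apart, since each is absorbed by [U_par] or [Us] without appeal to idempotence. *)
Definition pair_limit L xs al : 'M[R[i]]_3 :=
  let P := perp_proj L (ref_point L) in
  let Q := perp_proj L (ref_point L - xs) in
  P *m (P *m al *m Q) *m Q.

Lemma conj_mxZ m n (z : R[i]) (A : 'M[R[i]]_(m, n)) :
  conj_mx (z *: A) = (z^*)%C *: conj_mx A.
Proof. by apply/matrixP => i j; rewrite !mxE rmorphM. Qed.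

Lemma conj_mx_cplx m n (A : 'M[R]_(m, n)) : conj_mx (cplx_mx A) = cplx_mx A.
Proof. by apply/matrixP => i j; rewrite !mxE; exact: conjc_real. Qed.

Lemma conj_perp_proj L (v : 'cV[R]_3) : conj_mx (perp_proj L v) = perp_proj L v.
Proof.
have -> : perp_proj L v = cplx_mx (1%:M - (L ^+ 2)^-1 *: (v *m v^T)).
  by rewrite /perp_proj /cplx_mx map_mxB map_mx1.
exact: conj_mx_cplx.
Qed.

Lemma perp_projN L (v : 'cV[R]_3) : perp_proj L (- v) = perp_proj L v.
Proof. by rewrite /perp_proj linearN /= mulNmx mulmxN opprK. Qed.

Lemma pair_termE k L xs y z al p : L != 0 ->
  pair_term k xs y z al p = (((4 * pi * L) ^+ 4)^-1)%:C%C *: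
    (expi (pair_phase k xs y z p) *: pair_amplitude k L xs y z al p).
Proof.
move=> L0; rewrite /pair_term /pair_amplitude !(green_kmat k _ _ L0).
have collect (g1 g2 g3 g4 : R[i]) (K1 K2 K3 K4 : 'M[R[i]]_3) :
    conj_mx (g1 *: K1) *m (g2 *: K2 *m al *m (g3 *: K3)) *m conj_mx (g4 *: K4) =
    ((g1^*)%C * (g2 * g3) * (g4^*)%C) *: (conj_mx K1 *m (K2 *m al *m K3) *m conj_mx K4).
  by rewrite !conj_mxZ -!scalemxAl -!scalemxAr -!scalemxAl !scalerA; congr (_ *: _); ring.
move: (kmat k L (in_plane p - y)) (kmat k L (in_plane p - z))
  (kmat k L (z - xs)) (kmat k L (xs - y)) => K1 K2 K3 K4.
rewrite collect scalerA; congr (_ *: _).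
have conjE (t x : R) : ((expi t * x%:C%C)^*)%C = expi (- t) * x%:C%C.
  by rewrite -conj_expi rmorphM; congr (_ * _); exact: conjc_real.
rewrite !conjE /pair_phase.
set c := (4 * pi * L)^-1.
have -> : ((4 * pi * L) ^+ 4)^-1 = c ^+ 4 by rewrite -exprVn.
set r1 := enorm (in_plane p - y); set r2 := enorm (in_plane p - z).
set r3 := enorm (z - xs); set r4 := enorm (xs - y).
have -> : k * (r2 - r1) + k * (r3 - r4) = - (k * r1) + (k * r2 + (k * r3 + - (k * r4))).
  by ring.
rewrite !expiD rmorphXn /=.
move: (expi _) (expi _) (expi _) (expi _) (c%:C)%C => e1 e2 e3 e4 cc.
ring.
Qed.

End PairTerm.

(** The window in coordinates and with a single constant, the form in which amplitude and phase are
    estimated. *)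
Definition near_ref (R : realType) (c L b h : R) (y : 'cV[R]_3) : Prop :=
  [/\ `|y 0 0| <= c * b, `|y 1 0| <= c * b & `|y ord_max 0 - L| <= c * h].

Lemma forall_ord3 (P : 'I_3 -> Prop) : P 0 -> P 1 -> P ord_max -> forall i, P i.
Proof.
move=> P0 P1 P2 [[|[|[|i]]] //= lti].
- by rewrite (_ : Ordinal lti = 0)//; exact: val_inj.
- by rewrite (_ : Ordinal lti = 1)//; exact: val_inj.
- by rewrite (_ : Ordinal lti = ord_max)//; exact: val_inj.
Qed.

Lemma sum_ord3 (R : realType) (F : 'I_3 -> R) :
  \sum_(i < 3) F i = F 0 + F 1 + F ord_max.
Proof.
rewrite !big_ord_recr big_ord0 /= add0r; congr (F _ + F _ + F _); exact: val_inj.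
Qed.

Lemma ref_pointE (R : realType) (L : R) :
  [/\ ref_point L 0 0 = 0, ref_point L 1 0 = 0 & ref_point L ord_max 0 = L].
Proof. by split; rewrite !mxE /= ?mulr0 ?mulr1. Qed.

Lemma in_planeE (R : realType) (p : R * R) :
  [/\ in_plane p 0 0 = p.1, in_plane p 1 0 = p.2 & in_plane p ord_max 0 = 0].
Proof. by split; rewrite !mxE. Qed.

Lemma enorm_ref_point (R : realType) (L : R) : 0 < L -> enorm (ref_point L) = L.
Proof.
move=> L0; have [r0 r1 r2] := ref_pointE L.
by rewrite /enorm sum_ord3 r0 r1 r2 expr0n !add0r sqrtr_sqr gtr0_norm.
Qed.

Lemma pair_amplitude_close (R : realType) (c M calpha : R) : 1 <= c -> 0 <= M -> exists C : R,
  forall (k L a b h eps : R), regime k L a b h M eps ->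
  eps <= 1 -> 6 * (2 * c + c * M) * eps <= 1 ->
  forall xs y z al, enorm (xs - ref_point L) = L ->
  near_ref c L b h y -> near_ref c L b h z -> frob al <= calpha ->
  forall p : plane R, `|p.1| <= c * a -> `|p.2| <= c * a ->
  closem (a / L) C (pair_amplitude k L xs y z al p) (pair_limit L xs al).
Proof.
move=> c1 M0; pose kappa := 2 * c + c * M.
have [C hC] := kmat_close kappa.
have c0 : 0 < c by exact: lt_le_trans c1.
have cM0 : 0 <= c * M by rewrite mulr_ge0// ltW.
eexists => k L a b h eps hreg eps1 keps xs y z al xsL hy hz hal p p1 p2.
have [k0 L0 a0 b0 h0 kh qeps _ _ _] := hreg.
have q0 := regime_q hreg; have q1 := le_trans qeps eps1.
have ba := regime_ba hreg; have kL := regime_kL hreg.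
have kq : 6 * kappa * (a / L) <= 1.
  by apply: le_trans keps; rewrite ler_wpM2l// /kappa; lra.
have k1 : 1 <= kappa by rewrite /kappa; lra.
have kqL : kappa * (a / L) * L = 2 * (c * a) + c * M * a.
  by rewrite /kappa; field; rewrite gt_eqF.
have cba : c * b <= c * a by rewrite ler_pM2l.
have ca0 : 0 <= c * a by rewrite mulr_ge0 ?(ltW c0) ?(ltW a0).
have cMa0 : 0 <= c * M * a by rewrite mulr_ge0 ?(ltW a0).
have cha : c * h <= c * M * a.
  rewrite -mulrA ler_pM2l// (le_trans (regime_hL hreg))// mulrAC.
  by rewrite ler_piMr// mulr_ge0// ltW.
have [r0 r1 r2] := ref_pointE L; have [i0 i1 i2] := in_planeE p.
have sE (u v : 'cV[R]_3) i : (u - v) i 0 = u i 0 - v i 0 by rewrite !mxE.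
have nE (u : 'cV[R]_3) i : (- u) i 0 = - u i 0 by rewrite !mxE.
have recv w : near_ref c L b h w ->
    closem (a / L) C (kmat k L (in_plane p - w)) (perp_proj L (ref_point L)).
  move=> [w0 w1 w2]; rewrite -perp_projN.
  apply: hC => //; first by rewrite enormN enorm_ref_point.
  rewrite kqL; apply: forall_ord3; rewrite !(sE, nE, i0, i1, i2, r0, r1, r2) opprK ?addr0.
  - by rewrite (le_trans (ler_normB _ _))//; lra.
  - by rewrite (le_trans (ler_normB _ _))//; lra.
  - by rewrite sub0r addrC distrC; lra.
have send w : near_ref c L b h w -> forall i,
    `|(w - xs) i 0 - (ref_point L - xs) i 0| <= kappa * (a / L) * L.
  move=> [w0 w1 w2]; rewrite kqL.
  by apply: forall_ord3; rewrite !sE opprB addrA subrK ?(r0, r1, r2) ?subr0; lra.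
have dL : enorm (ref_point L - xs) = L by rewrite -opprB enormN.
have sz : closem (a / L) C (kmat k L (z - xs)) (perp_proj L (ref_point L - xs)).
  by apply: hC => //; exact: send.
have sy : closem (a / L) C (kmat k L (xs - y)) (perp_proj L (ref_point L - xs)).
  rewrite -perp_projN; apply: hC => //; first by rewrite enormN.
  move=> i; have := send y hy i; rewrite -normrN; congr (`| _ | <= _).
  by rewrite !mxE; ring.
have hal' : closem (a / L) (9 * calpha) al al.
  apply: (closem_refl (ltW q0)); rewrite (le_trans (mxn_le_frob _))//.
  by rewrite ler_wpM2l.
rewrite /pair_amplitude /pair_limit.
apply: (closemM q1); last first.
  by rewrite -conj_perp_proj; exact: (closem_conj sy).
apply: (closemM q1).
  by rewrite -conj_perp_proj; exact: (closem_conj (recv y hy)).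
by apply: (closemM q1) sz; apply: (closemM q1) hal'; exact: recv.
Qed.

Definition bounded_array (R : realType) (c a : R) (A : set (R * R)) : Prop :=
  [/\ (forall p, A p -> `|p.1| <= c * a /\ `|p.2| <= c * a),
      (area_measure R A < +oo)%E, a ^+ 2 / c <= mes A & mes A <= c * a ^+ 2].

Lemma cross_rangeE (R : realType) (y : 'cV[R]_3) :
  (cross_range y) 0 0 = y 0 0 /\ (cross_range y) 1 0 = y 1 0.
Proof. by split; rewrite mxE; congr (y _ _); exact: val_inj. Qed.

Lemma enorm_cross_sqr (R : realType) (y z : 'cV[R]_3) :
  enorm (cross_range z - cross_range y) ^+ 2 = (z 0 0 - y 0 0) ^+ 2 + (z 1 0 - y 1 0) ^+ 2.
Proof.
have [y0 y1] := cross_rangeE y; have [z0 z1] := cross_rangeE z.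
rewrite enorm_sqr big_ord_recr big_ord1 /=.
rewrite (_ : widen_ord _ _ = 0); last exact: val_inj.
rewrite (_ : ord_max = 1); last exact: val_inj.
have sE (u v : 'cV[R]_2) i : (u - v) i 0 = u i 0 - v i 0 by rewrite !mxE.
by rewrite !sE y0 y1 z0 z1.
Qed.

Lemma enorm_in_plane_sqr (R : realType) (L : R) (y : 'cV[R]_3) (p : R * R) :
  enorm (in_plane p - y) ^+ 2 =
    (p.1 - y 0 0) ^+ 2 + (p.2 - y 1 0) ^+ 2 + (L + (y ord_max 0 - L)) ^+ 2.
Proof.
have [i0 i1 i2] := in_planeE p.
have sE (u v : 'cV[R]_3) i : (u - v) i 0 = u i 0 - v i 0 by rewrite !mxE.
by rewrite enorm_sqr sum_ord3 !sE i0 i1 i2 sub0r sqrrN subrKC.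
Qed.

Lemma measurable_pair_phase (R : realType) (k : R) (xs y z : 'cV[R]_3) :
  measurable_fun setT (pair_phase k xs y z).
Proof.
apply: measurable_funD; last exact: measurable_cst.
apply: measurable_funM; first exact: measurable_cst.
by apply: measurable_funB; exact: measurable_enorm_in_plane.
Qed.

(** The exponential is compared with that of its linear part: the difference is small pointwise
    because the exponential is Lipschitz, and the linear part, of frequency k w / L, oscillates. *)
Lemma cint_pair_phase_le (R : realType) (D : set (R * R)) (c M : R) :
  planar_shape D -> 1 <= c -> 0 <= M -> exists2 C : R, 0 < C &
  forall (k L a b h eps : R), regime k L a b h M eps ->
  c * M * eps ^+ 2 <= 1 / 2 -> bounded_array c a (scaled_array a D) ->
  forall xs y z, near_ref c L b h y -> near_ref c L b h z ->
  cross_range y <> cross_range z ->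
  cnorm (cint (scaled_array a D) (fun p => expi (pair_phase k xs y z p))) <=
    C * (a ^+ 2 * Theta k L a / L ^+ 2 + Theta k L b +
         L / (a * k * enorm (cross_range z - cross_range y))) * mes (scaled_array a D).
Proof.
move=> hD c1 M0; have [c2 c20 hc2] := cint_linear_phase hD.
have c0 : 0 < c by exact: lt_le_trans c1.
have [c3 c30 c3E] : exists2 c3, 0 < c3 & 104 * c ^+ 4 * (1 + M) = c3.
  by eexists; last reflexivity; rewrite !mulr_gt0 ?exprn_gt0//; lra.
exists (4 * c3 + c2 * c); first by rewrite addr_gt0// mulr_gt0.
move=> k L a b h eps hreg ceps [hA fA mesA _] xs y z hy hz yz.
have [k0 L0 a0 b0 h0 _ _ _ _ _] := hreg.
set A := scaled_array a D in hA fA mesA *.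
set tau := a ^+ 2 * _ / _; set beta := Theta k L b.
pose w := enorm (cross_range z - cross_range y); rewrite -/w.
have mA : measurable (A : set (plane R)) by exact: scaled_array_measurable.
pose x1 := - (k / L * (z 0 0 - y 0 0)); pose x2 := - (k / L * (z 1 0 - y 1 0)).
pose t := k * ((z ord_max 0 - L) - (y ord_max 0 - L)) +
  k * (enorm (z - xs) - enorm (xs - y)).
pose lin (p : plane R) := x1 * p.1 + x2 * p.2 + t.
have mlin : measurable_fun setT lin.
  by apply: measurable_funD => //; apply: measurable_funD; apply: measurable_funM.
have w2 := enorm_cross_sqr y z; rewrite -/w in w2.
have w0 : 0 < w.
  rewrite lt0r enorm_ge0 andbT; apply/eqP => wE; apply: yz.
  move: w2; rewrite wE expr0n /= => /esym/eqP.
  rewrite paddr_eq0 ?sqr_ge0// !sqrf_eq0 !subr_eq0 => /andP[/eqP e0 /eqP e1].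
  have [y0 y1] := cross_rangeE y; have [z0 z1] := cross_rangeE z.
  apply/matrixP => i j; rewrite ord1; case: i => -[|[|i]] //= lti.
    by rewrite (_ : Ordinal lti = 0) ?y0 ?z0//; exact: val_inj.
  by rewrite (_ : Ordinal lti = 1) ?y1 ?z1//; exact: val_inj.
have x12 : Num.sqrt (x1 ^+ 2 + x2 ^+ 2) = k / L * w.
  rewrite (_ : x1 ^+ 2 + x2 ^+ 2 = (k / L * w) ^+ 2); last first.
    by rewrite exprMn w2 /x1 /x2; ring.
  by rewrite sqrtr_sqr ger0_norm// mulr_ge0 ?(ltW w0)// divr_ge0 ?ltW.
have xn0 : (x1, x2) != (0, 0).
  apply/eqP => -[e1 e2]; move: x12; rewrite e1 e2 expr0n /= addr0 sqrtr0 => /esym/eqP.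
  by rewrite gt_eqF// mulr_gt0// divr_gt0.
have near_lin p : A p -> `|pair_phase k xs y z p - lin p| <= c3 * (tau + beta).
  move=> Ap; have [p1 p2] := hA p Ap.
  have [y0 y1 y2] := hy; have [z0 z1 z2] := hz.
  have := @phase_expansion R k L a b h M eps hreg c p.1 p.2 (y 0 0) (y 1 0)
    (y ord_max 0 - L) (z 0 0) (z 1 0) (z ord_max 0 - L) (enorm (in_plane p - y))
    (enorm (in_plane p - z)) c1 ceps p1 p2 y0 y1 y2 z0 z1 z2 (enorm_ge0 _)
    (enorm_in_plane_sqr _ _ _) (enorm_ge0 _) (enorm_in_plane_sqr _ _ _).
  rewrite c3E; apply: le_trans; rewrite /pair_phase /lin /x1 /x2 /t le_eqVlt; apply/orP; left.
  by apply/eqP; congr `| _ |; ring.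
have mph := cmeas_expi (measurable_pair_phase k xs y z).
have ml := cmeas_expi mlin.
have bdiff : cbounded A (fun p => expi (pair_phase k xs y z p) - expi (lin p)).
  split; first exact: cmeasB.
  by exists 2 => p _; rewrite (le_trans (cnormB _ _))// !cnorm_expi.
have blin : cbounded A (fun p => expi (lin p)).
  by split => //; exists 1 => p _; rewrite cnorm_expi.
have -> : cint A (fun p => expi (pair_phase k xs y z p)) =
    cint A (fun p => expi (pair_phase k xs y z p) - expi (lin p)) +
    cint A (fun p => expi (lin p)).
  by rewrite -(cintD mA fA bdiff blin); congr cint; apply/funext => p; rewrite subrK.
rewrite (le_trans (cnormD _ _))//.
have d1 : cnorm (cint A (fun p => expi (pair_phase k xs y z p) - expi (lin p))) <=
    2 * (2 * (c3 * (tau + beta))) * mes A.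
  apply: (cnorm_cint_le mA fA bdiff.1) => p Ap.
  by rewrite (le_trans (expi_lipschitz _ _))// ler_wpM2l// near_lin.
have d2 := hc2 a x1 x2 t a0 xn0; rewrite x12 -/A -/lin in d2.
have mes0 : 0 < mes A by apply: lt_le_trans mesA; rewrite divr_gt0 ?exprn_gt0.
have cr0 : 0 < L / (a * k * w) by rewrite divr_gt0 ?mulr_gt0.
(* The bound a / (k w / L) equals a^2 times L / (a k w), and a^2 <= c mes A turns it into a multiple
   of the area. *)
have d3 : c2 * a / (k / L * w) <= c2 * c * (L / (a * k * w)) * mes A.
  have -> : c2 * a / (k / L * w) = c2 * c * (L / (a * k * w)) * (a ^+ 2 / c).
    by field; rewrite !gt_eqF.
  by rewrite ler_wpM2l// mulr_ge0 ?(ltW cr0)// mulr_ge0// ltW.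
have tau0 : 0 <= tau by apply: le_trans (regime_q2_tau hreg); exact: sqr_ge0.
have beta0 : 0 <= beta by rewrite /beta /Theta divr_ge0 ?mulr_ge0 ?sqr_ge0 ?ltW.
rewrite (le_trans (lerD d1 (le_trans d2 d3)))//.
have e1 : 0 <= c3 * (L / (a * k * w)) * mes A.
  by rewrite mulr_ge0 ?(ltW mes0)// mulr_ge0 ?(ltW cr0)// ltW.
have e2 : 0 <= c2 * c * (tau + beta) * mes A.
  by rewrite mulr_ge0 ?(ltW mes0)// mulr_ge0 ?addr_ge0// mulr_ge0// ltW.
have -> : (4 * c3 + c2 * c) * (tau + beta + L / (a * k * w)) * mes A =
  4 * c3 * (tau + beta) * mes A + 4 * (c3 * (L / (a * k * w)) * mes A) +
  (c2 * c * (tau + beta) * mes A + c2 * c * (L / (a * k * w)) * mes A) by ring.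
have -> : 2 * (2 * (c3 * (tau + beta))) * mes A = 4 * c3 * (tau + beta) * mes A by ring.
lra.
Qed.

Definition pair_image (R : realType) (A : set (R * R)) (k L : R)
    (xs y z : 'cV[R]_3) (al : 'M[R[i]]_3) : 'M[R[i]]_3 :=
  ((4 * pi * L) ^+ 4 / mes A)%:C%C *: mx_integral A (pair_term k xs y z al).

Lemma mmeas_pair_amplitude (R : realType) (k L : R) (xs y z : 'cV[R]_3) al :
  mmeas (pair_amplitude k L xs y z al).
Proof.
apply: mmeasM; last exact: mmeas_cst.
apply: mmeasM; first by apply: mmeas_conj; exact: mmeas_kmat.
apply: mmeasM; last exact: mmeas_cst.
by apply: mmeasM; [exact: mmeas_kmat|exact: mmeas_cst].
Qed.

(** The amplitude is replaced by its limit under the integral, the phase factor having modulus 1;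
    what remains is a scalar average times a fixed matrix. The boundedness conclusion later allows
    the sum over dipoles to leave the integral. *)
Lemma pair_image_close (R : realType) (c M calpha : R) : 1 <= c -> 0 <= M -> exists C : R,
  forall (k L a b h eps : R), regime k L a b h M eps ->
  eps <= 1 -> 6 * (2 * c + c * M) * eps <= 1 ->
  forall xs y z al, enorm (xs - ref_point L) = L ->
  near_ref c L b h y -> near_ref c L b h z -> frob al <= calpha ->
  forall A : set (R * R), measurable (A : set (plane R)) -> bounded_array c a A ->
  [/\ mbounded A (pair_term k xs y z al), mxn (pair_limit L xs al) <= C &
   mxn (pair_image A k L xs y z al -
     (cint A (fun p => expi (pair_phase k xs y z p)) * ((mes A)^-1)%:C%C)
       *: pair_limit L xs al) <= C * (a / L)].
Proof.
move=> c1 M0; have [C hC] := pair_amplitude_close calpha c1 M0.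
have c0 : 0 < c by exact: lt_le_trans c1.
(* 18 = 9 * 2: nine entries, and the factor 2 from real and imaginary parts. *)
exists (18 * `|C|) => k L a b h eps hreg eps1 keps xs y z al xsL hy hz hal A mA [hA fA mesA _].
have [k0 L0 a0 _ _ _ _ _ _ _] := hreg; have q0 := regime_q hreg.
have mes0 : 0 < mes A by apply: lt_le_trans mesA; rewrite divr_gt0 ?exprn_gt0.
set B := pair_limit _ _ _; pose H := pair_amplitude k L xs y z al.
pose f p := expi (pair_phase k xs y z p).
have q1 : a / L <= 1 by apply: le_trans eps1; exact: regime_eps hreg.
have close p : A p -> closem (a / L) C (H p) B.
  by move=> Ap; have [p1 p2] := hA p Ap; exact: (hC k L a b h eps).
have mf : cmeas f := cmeas_expi (measurable_pair_phase k xs y z).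
have mH : mmeas H := mmeas_pair_amplitude _ _ _ _ _ _.
have bf : cbounded A f by split => //; exists 1 => p _; rewrite cnorm_expi.
have mfd : mmeas (fun p => f p *: (H p - B)).
  by apply: mmeas_scale => //; apply: mmeasB => //; exact: mmeas_cst.
have fdle p : A p -> mxn (f p *: (H p - B)) <= `|C| * (a / L).
  move=> /close [_ h2]; rewrite mxnZ cnorm_expi mul1r (le_trans h2)//.
  by rewrite ler_wpM2r ?ler_norm// ltW.
have bfd : mbounded A (fun p => f p *: (H p - B)) by split => //; exists (`|C| * (a / L)).
have bfB : mbounded A (fun p => f p *: B).
  split; first by apply: mmeas_scale => //; exact: mmeas_cst.
  by exists (mxn B) => p _; rewrite mxnZ cnorm_expi mul1r.
have mfH : mmeas (fun p => f p *: H p) by exact: mmeas_scale.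
have bfH : mbounded A (fun p => f p *: H p).
  split => //; exists (2 * C) => p /close cl.
  by rewrite mxnZ cnorm_expi mul1r (closem_norm q1 cl).
set g4 := (4 * pi * L) ^+ 4.
have g40 : g4 != 0 by rewrite gt_eqF// exprn_gt0// !mulr_gt0 ?pi_gt0.
have pairE : pair_term k xs y z al = (fun p => (g4^-1)%:C%C *: (f p *: H p)).
  by apply/funext => p; rewrite (pair_termE _ _ _ _ _ _ (lt0r_neq0 L0)).
(* The bound on the limit matrix is part of closeness at a receiver, so one receiver is needed;
   positive area provides it. *)
have [p Ap] : A !=set0.
  apply/set0P/eqP => A0; move: mes0; rewrite /mes A0 measure0 ltxx; exact: notF.
have C0 : 0 <= `|C| by [].
split.
- rewrite pairE; split.
    by apply: mmeas_scale => //; exact: cmeas_cst.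
  have [_ [d hd]] := bfH.
  exists (cnorm (g4^-1)%:C%C * d) => p' Ap'; rewrite mxnZ.
  by rewrite ler_wpM2l ?cnorm_ge0// hd.
- have [h1 _] := close p Ap; rewrite (le_trans h1)// (le_trans (ler_norm _))//.
  lra.
have -> : pair_image A k L xs y z al - (cint A f * ((mes A)^-1)%:C%C) *: B =
    ((mes A)^-1)%:C%C *: mx_integral A (fun p => f p *: (H p - B)).
  rewrite /pair_image pairE (mx_integralZ mA fA _ bfH) scalerA -rmorphM.
  have -> : g4 / mes A * g4^-1 = (mes A)^-1 by field; rewrite g40 gt_eqF.
  have -> : (fun p => f p *: H p) = (fun p => f p *: (H p - B) + f p *: B).
    by apply/funext => p'; rewrite -scalerDr subrK.
  rewrite (mx_integralD mA fA bfd bfB) scalerDr (mx_integral_cst mA fA _ bf) scalerA.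
  by rewrite [in X in _ - X]mulrC addrK.
rewrite mxnZ cnorm_real ger0_norm ?invr_ge0 ?(ltW mes0)//.
have := mxn_mx_integral_le mA fA mfd fdle.
rewrite -(ler_pM2l (_ : 0 < (mes A)^-1)) ?invr_gt0//.
move/le_trans; apply; rewrite le_eqVlt; apply/orP; left.
by apply/eqP; field; rewrite !gt_eqF.
Qed.

Lemma cint_cst1 (R : realType) (A : set (plane R)) : measurable A ->
  cint A (fun=> 1) = (mes A)%:C%C.
Proof.
by move=> mA; rewrite /cint /= !Rintegral_cst// mul1r mul0r.
Qed.

Lemma pair_image_near (R : realType) (c M calpha : R) : 1 <= c -> 0 <= M -> exists C : R,
  forall (k L a b h eps : R), regime k L a b h M eps ->
  eps <= 1 -> 6 * (2 * c + c * M) * eps <= 1 ->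
  forall xs y al, enorm (xs - ref_point L) = L ->
  near_ref c L b h y -> frob al <= calpha ->
  forall A : set (R * R), measurable (A : set (plane R)) -> bounded_array c a A ->
  mxn (pair_image A k L xs y y al - pair_limit L xs al) <= C * (a / L).
Proof.
move=> c1 M0; have [C hC] := pair_image_close calpha c1 M0.
have c0 : 0 < c by exact: lt_le_trans c1.
exists C => k L a b h eps hreg eps1 keps xs y al xsL hy hal A mA bA.
have [_ _] := hC _ _ _ _ _ _ hreg eps1 keps _ _ _ _ xsL hy hy hal A mA bA.
have [_ _ mesA _] := bA; have [_ _ a0 _ _ _ _ _ _ _] := hreg.
have mes0 : 0 < mes A by apply: lt_le_trans mesA; rewrite divr_gt0 ?exprn_gt0.
have -> : (fun p => expi (pair_phase k xs y y p)) = (fun=> 1).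
  apply/funext => p; rewrite /pair_phase subrr mulr0 add0r.
  by rewrite -(enormN (y - xs)) opprB subrr mulr0 expi0.
by rewrite cint_cst1// -rmorphM divff ?gt_eqF// scale1r.
Qed.

Lemma pair_image_far (R : realType) (D : set (R * R)) (c M calpha : R) :
  planar_shape D -> 1 <= c -> 0 <= M -> exists C : R,
  forall (k L a b h eps : R), regime k L a b h M eps ->
  eps <= 1 -> 6 * (2 * c + c * M) * eps <= 1 -> c * M * eps ^+ 2 <= 1 / 2 ->
  bounded_array c a (scaled_array a D) ->
  forall xs y z al, enorm (xs - ref_point L) = L ->
  near_ref c L b h y -> near_ref c L b h z -> frob al <= calpha ->
  cross_range y <> cross_range z ->
  mxn (pair_image (scaled_array a D) k L xs y z al) <=
    C * (a / L + a ^+ 2 * Theta k L a / L ^+ 2 + Theta k L b +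
         L / (a * k * enorm (cross_range z - cross_range y))).
Proof.
move=> hD c1 M0; have [C hC] := pair_image_close calpha c1 M0.
have [C2 C20 hC2] := cint_pair_phase_le hD c1 M0.
have c0 : 0 < c by exact: lt_le_trans c1.
exists (`|C| + `|C| * C2) => k L a b h eps hreg eps1 keps ceps bA xs y z al xsL hy hz hal yz.
have [k0 L0 a0 b0 _ _ _ _ _ _] := hreg.
have mA := scaled_array_measurable hD a0.
have [_ nB close] := hC _ _ _ _ _ _ hreg eps1 keps _ _ _ _ xsL hy hz hal _ mA bA.
have ph := hC2 _ _ _ _ _ _ hreg ceps bA xs y z hy hz yz.
have [_ _ mesA _] := bA.
set A := scaled_array a D in mA close ph mesA bA *.
have mes0 : 0 < mes A by apply: lt_le_trans mesA; rewrite divr_gt0 ?exprn_gt0.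
set I := cint A _ in close ph.
set cr := L / _ in ph *; set tau := a ^+ 2 * _ / _ in ph *.
set beta := Theta k L b in ph *.
have cr0 : 0 <= cr by rewrite divr_ge0 ?mulr_ge0 ?enorm_ge0 ?ltW.
have tau0 : 0 <= tau by apply: le_trans (regime_q2_tau hreg); exact: sqr_ge0.
have beta0 : 0 <= beta by rewrite /beta /Theta divr_ge0 ?mulr_ge0 ?sqr_ge0 ?ltW.
have q0 := ltW (regime_q hreg).
rewrite -(subrK ((I * ((mes A)^-1)%:C%C) *: pair_limit L xs al) (pair_image _ _ _ _ _ _ _)).
rewrite (le_trans (mxnD _ _))//.
have e1 : mxn ((I * ((mes A)^-1)%:C%C) *: pair_limit L xs al) <=
    (C2 * (tau + beta + cr)) * `|C|.
  rewrite mxnZ ler_pM ?cnorm_ge0 ?mxn_ge0//; last by rewrite (le_trans nB)// ler_norm.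
  rewrite cnormM cnorm_real ger0_norm ?invr_ge0 ?(ltW mes0)//.
  by rewrite ler_pdivrMr.
have e2 : C * (a / L) <= `|C| * (a / L) by rewrite ler_wpM2r// ler_norm.
rewrite (le_trans (lerD (le_trans close e2) e1))//.
have C0 : 0 <= `|C| by [].
have u1 : 0 <= `|C| * (tau + beta + cr) by rewrite mulr_ge0// !addr_ge0.
have u2 : 0 <= `|C| * C2 * (a / L) by rewrite mulr_ge0// mulr_ge0// ltW.
have -> : (`|C| + `|C| * C2) * (a / L + tau + beta + cr) =
  `|C| * (a / L) + `|C| * (tau + beta + cr) + (`|C| * C2 * (a / L)) +
  C2 * (tau + beta + cr) * `|C| by ring.
lra.
Qed.

(** * Reconstruction *)

Lemma adj_mx_cplx (R : realType) m n (A : 'M[R]_(m, n)) :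
  adj_mx (cplx_mx A) = cplx_mx A^T.
Proof. by rewrite /adj_mx conj_mx_cplx /cplx_mx map_trmx. Qed.

Lemma U_par_perp_ref (R : realType) (L : R) : (U_par R)^T *m ref_point L = 0.
Proof.
have [r0 r1 r2] := ref_pointE L.
apply/matrixP => j l; rewrite ord1 mxE sum_ord3 r0 r1 r2 !mulr0 !add0r !mxE.
by case: j => -[|[|j]] //= ltj; rewrite mul0r.
Qed.

Lemma perp_basis_orthogonal (R : realType) (d : 'cV[R]_3) (U : 'M[R]_(3, 2)) :
  orthonormal_basis_of_perp d U -> d^T *m U = 0.
Proof.
move=> [_ hU]; apply/matrixP => i j.
have := (hU (U *m delta_mx j 0)).2 (ex_intro _ (delta_mx j 0) erefl).
rewrite mulmxA -colE => /matrixP/(_ i 0); rewrite ord1 mxE => ->.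
by rewrite !mxE.
Qed.

(** [U_par] is orthogonal to the axis and [Us] to the source direction, so on the left and on the
    right the projections act as the identity. *)
Lemma alpha_proj_limit (R : realType) (L : R) (xs : 'cV[R]_3) (Us : 'M[R]_(3, 2)) al :
  orthonormal_basis_of_perp (ref_point L - xs) Us ->
  adj_mx (cplx_mx (U_par R)) *m pair_limit L xs al *m cplx_mx Us = alpha_proj Us al.
Proof.
move=> /perp_basis_orthogonal dU.
have EU : adj_mx (cplx_mx (U_par R)) *m perp_proj L (ref_point L) =
    adj_mx (cplx_mx (U_par R)).
  rewrite adj_mx_cplx /perp_proj mulmxBr mulmx1 -cplx_mxM -scalemxAr mulmxA.
  by rewrite U_par_perp_ref mul0mx scaler0 /cplx_mx map_mx0 subr0.
have EUs : perp_proj L (ref_point L - xs) *m cplx_mx Us = cplx_mx Us.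
  rewrite /perp_proj mulmxBl mul1mx -cplx_mxM -scalemxAl -mulmxA dU.
  by rewrite mulmx0 scaler0 /cplx_mx map_mx0 subr0.
by rewrite /pair_limit /alpha_proj !mulmxA !EU -!mulmxA !EUs.
Qed.

Lemma mxn_U_par (R : realType) : mxn (adj_mx (cplx_mx (U_par R))) <= 6.
Proof.
rewrite adj_mx_cplx mxn_cplx.
have entry i j : `|(U_par R)^T i j| <= 1.
  by rewrite !mxE; case: (_ == _); rewrite ?normr1 ?normr0.
apply: le_trans (sum_le_card (fun i => sum_le_card (entry i))) _; lra.
Qed.

Lemma mxn_orthonormal (R : realType) (U : 'M[R]_(3, 2)) :
  U^T *m U = 1%:M -> mxn (cplx_mx U) <= 6.
Proof.
move=> UU; have U1 i j : `|U i j| <= 1.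
  have E : \sum_l U l j ^+ 2 = 1.
    move/matrixP: UU => /(_ j j); rewrite !mxE eqxx mulr1n => <-.
    by apply: eq_bigr => l _; rewrite mxE expr2.
  rewrite -(@ler_pXn2r _ 2) ?nnegrE// real_normK ?num_real// expr1n -E.
  by rewrite (bigD1 i)//= lerDl sumr_ge0// => l _; exact: sqr_ge0.
rewrite mxn_cplx.
apply: le_trans (sum_le_card (fun i => sum_le_card (U1 i))) _; lra.
Qed.

Lemma frob_sandwich (R : realType) (Us : 'M[R]_(3, 2)) (X : 'M[R[i]]_3) :
  Us^T *m Us = 1%:M ->
  frob (adj_mx (cplx_mx (U_par R)) *m X *m cplx_mx Us) <= 36 * mxn X.
Proof.
move=> UU; rewrite (le_trans (frob_le_mxn _))// (le_trans (mxnM _ _))//.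
have -> : 36 * mxn X = 6 * mxn X * 6 by ring.
rewrite ler_pM ?mxn_ge0 ?mxn_orthonormal// (le_trans (mxnM _ _))//.
by rewrite ler_wpM2r ?mxn_ge0 ?mxn_U_par.
Qed.

Lemma alpha_rec_sum (R : realType) (N : nat) (A : set (R * R)) (k L : R)
    (ys : 'I_N -> 'cV[R]_3) (alphas : 'I_N -> 'M[R[i]]_3) xs Us y :
  measurable (A : set (plane R)) -> (area_measure R A < +oo)%E ->
  (forall n, mbounded A (pair_term k xs y (ys n) (alphas n))) ->
  alpha_rec A k L ys alphas xs Us y =
  adj_mx (cplx_mx (U_par R)) *m
    (\sum_(n < N) pair_image A k L xs y (ys n) (alphas n)) *m cplx_mx Us.
Proof.
move=> mA fA bt; rewrite /alpha_rec scalemxAl scalemxAr; congr (_ *m _ *m _).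
rewrite /pair_image -scaler_sumr; congr (_ *: _).
rewrite -(mx_integral_sum mA fA)// /I_KM; congr mx_integral; apply/funext => p.
by rewrite /array_data mulmx_sumr mulmx_suml.
Qed.

Lemma in_window_near_ref (R : realType) (cpar ceta c L b h : R) y :
  0 < b -> 0 < h -> cpar <= c -> ceta <= c ->
  in_window cpar ceta L b h y -> near_ref c L b h y.
Proof.
move=> b0 h0 cp ce [w1 w2]; have [y0 y1] := cross_rangeE y.
have cpb : cpar * b <= c * b by rewrite ler_pM2r.
have ceh : ceta * h <= c * h by rewrite ler_pM2r.
split; last exact: le_trans w2 ceh.
- by rewrite -y0 (le_trans (coord_le_enorm _ _))// (le_trans w1).
- by rewrite -y1 (le_trans (coord_le_enorm _ _))// (le_trans w1).
Qed.

(* Within the window every cross-range distance is O(b), and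
   (a^2 k b / L^2)^2 = (a^2 Theta_a / L^2) Theta_b <= 1. *)
Lemma aspect_le_cross (R : realType) (c k L a b h M eps : R) y z :
  regime k L a b h M eps -> 0 < c -> near_ref c L b h y -> near_ref c L b h z ->
  0 < enorm (cross_range z - cross_range y) ->
  a / L <= 4 * c * (L / (a * k * enorm (cross_range z - cross_range y))).
Proof.
move=> hreg c0 [y0 y1 _] [z0 z1 _]; set w := enorm _ => w0.
have [k0 L0 a0 b0 _ _ _ _ TB TA] := hreg.
have wb : w <= 4 * (c * b).
  have cb4 : 0 <= 4 * (c * b) by rewrite mulr_ge0// mulr_ge0// ltW.
  rewrite -(@ler_pXn2r _ 2) ?nnegrE ?(ltW w0)// enorm_cross_sqr.
  have sq (s t : R) : `|s| <= c * b -> `|t| <= c * b -> (t - s) ^+ 2 <= 4 * (c * b) ^+ 2.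
    move=> hs ht; have -> : 4 * (c * b) ^+ 2 = (2 * (c * b)) ^+ 2 by ring.
    have cb2 : 0 <= 2 * (c * b) by rewrite mulr_ge0// mulr_ge0// ltW.
    rewrite -real_normK ?num_real// ler_sqr ?nnegrE//.
    by rewrite (le_trans (ler_normB _ _))//; lra.
  have := sq _ _ y0 z0; have := sq _ _ y1 z1; have := sqr_ge0 (c * b).
  have -> : (4 * (c * b)) ^+ 2 = 16 * (c * b) ^+ 2 by ring.
  lra.
have key : a ^+ 2 * k * b <= L ^+ 2.
  have akb0 : 0 < a ^+ 2 * k * b by rewrite !mulr_gt0 ?exprn_gt0.
  rewrite -(@ler_pXn2r _ 2) ?nnegrE ?(ltW akb0) ?sqr_ge0//.
  have L4 : 0 < L ^+ 4 by rewrite exprn_gt0.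
  have T0 (x : R) : 0 <= Theta k L x.
    apply: divr_ge0; last exact: ltW.
    by apply: mulr_ge0; [exact: ltW|exact: sqr_ge0].
  have tau0 : 0 <= a ^+ 2 * Theta k L a / L ^+ 2.
    apply: divr_ge0; last exact: sqr_ge0.
    by apply: mulr_ge0 => //; exact: sqr_ge0.
  have : (a ^+ 2 * k * b) ^+ 2 / L ^+ 4 <= 1.
    have := ler_pM tau0 (T0 b) TA TB; rewrite mulr1; apply: le_trans.
    by rewrite le_eqVlt; apply/orP; left; apply/eqP; rewrite /Theta; field; rewrite gt_eqF.
  by rewrite ler_pdivrMr// mul1r -exprM.
rewrite mulrA ler_pdivlMr ?mulr_gt0//.
have -> : a / L * (a * k * w) = a ^+ 2 * k * w / L by ring.
rewrite ler_pdivrMr//.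
rewrite (@le_trans _ _ (a ^+ 2 * k * (4 * (c * b))))//.
  by rewrite ler_pM2l// mulr_gt0// exprn_gt0.
have -> : a ^+ 2 * k * (4 * (c * b)) = 4 * c * (a ^+ 2 * k * b) by ring.
by rewrite -[leRHS]mulrA -expr2 ler_pM2l// mulr_gt0.
Qed.

Lemma sum_le_const (R : realType) n (P : pred 'I_n) (F : 'I_n -> R) (e : R) : 0 <= e ->
  (forall i, P i -> F i <= e) -> \sum_(i < n | P i) F i <= n%:R * e.
Proof.
move=> e0 Fe; rewrite big_mkcond sum_le_card// => i.
by case: ifP => // /Fe.
Qed.

Lemma mxn_sum (R : realType) (I : Type) (r : seq I) (P : pred I) m n
    (F : I -> 'M[R[i]]_(m, n)) :
  mxn (\sum_(i <- r | P i) F i) <= \sum_(i <- r | P i) mxn (F i).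
Proof.
elim/big_rec2: _ => [|i x z _ h].
  by rewrite /mxn big1// => i _; rewrite big1// => j _; rewrite mxE Normc.normc0.
by rewrite (le_trans (mxnD _ _))// lerD2l.
Qed.

(** A real-valued substitute for the bound through the minimum: it treats the selected dipoles one
    by one and holds trivially if there are none. *)
Definition cross_bound (R : realType) (N : nat) (k L a : R) (ys : 'I_N -> 'cV[R]_3)
    (P : pred 'I_N) (y : 'cV[R]_3) (x : R) : Prop :=
  forall j, P j -> 0 < enorm (cross_range (ys j) - cross_range y) /\
    L / (a * k * enorm (cross_range (ys j) - cross_range y)) <= x.

(** A vanishing minimum makes the term infinite. Otherwise the term is a real number that dominates
    L / (a k w) for every selected distance w. *)
Lemma cross_termP (R : realType) (N : nat) (k L a : R) (ys : 'I_N -> 'cV[R]_3)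
    (P : pred 'I_N) (y : 'cV[R]_3) : 0 < k -> 0 < L -> 0 < a ->
  cross_term k L a (min_cross_dist ys P y) = +oo%E \/
  exists2 x, 0 <= x & cross_term k L a (min_cross_dist ys P y) = x%:E /\
    cross_bound k L a ys P y x.
Proof.
move=> k0 L0 a0; have ak0 : 0 < a * k by rewrite mulr_gt0.
set d := min_cross_dist ys P y.
have dle j : P j -> (d <= (enorm (cross_range (ys j) - cross_range y))%:E)%E.
  move=> Pj; rewrite -(enormN (_ - _)) opprB.
  exact: (bigmin_le_cond (+oo%E) (fun j => (enorm (cross_range y - cross_range (ys j)))%:E) Pj).
have [dy|[r r0 dr]] : d = +oo%E \/ exists2 r, 0 <= r & d = r%:E.
  rewrite /d /min_cross_dist; elim/big_rec: _ => [|i x _ [->|[r r0 ->]]].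
  - by left.
  - right; exists (enorm (cross_range y - cross_range (ys i))); first exact: enorm_ge0.
    by rewrite minElt ltry.
  - right; exists (Num.min (enorm (cross_range y - cross_range (ys i))) r).
      by rewrite le_min enorm_ge0 r0.
    by rewrite EFin_min.
(* Minimum +oo: no dipole is selected, the term is 0 and there is nothing to bound. *)
- right; exists 0 => //; split.
    by rewrite /cross_term dy mulry gtr0_sg// mul1e invey mule0.
  by move=> j /dle; rewrite dy leye_eq.
have [rE|rn0] := eqVneq r 0.
  left; rewrite /cross_term dr rE mule0 inve0 mulry gtr0_sg// mul1e //.
have rp : 0 < r by rewrite lt0r rn0.
right; exists (L / (a * k * r)); first by rewrite divr_ge0 ?mulr_ge0 ?ltW.
split.
  rewrite /cross_term dr -EFinM inver mulf_eq0 (gt_eqF ak0) (negbTE rn0) /= -EFinM //.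
move=> j /dle; rewrite dr lee_fin => rw.
have w0 := lt_le_trans rp rw; split => //.
rewrite ler_pM2l// lef_pV2 ?posrE ?(mulr_gt0 ak0)// ler_pM2l//.
Qed.

(** Both estimates at fixed parameters, with [C] and [eps] chosen before them; this order is what
    makes the final constant uniform. *)
Lemma alpha_rec_bounds (R : realType) (D : set (R * R)) (N : nat)
    (cpar ceta calpha M : R) : planar_shape D -> 0 <= M ->
  exists C eps : R, [/\ 0 < C, 0 < eps &
  forall (k L a b h : R), regime k L a b h M eps ->
  forall (xs : 'cV[R]_3) (Us : 'M[R]_(3, 2))
         (ys : 'I_N -> 'cV[R]_3) (alphas : 'I_N -> 'M[R[i]]_3),
  enorm (xs - ref_point L) = L ->
  orthonormal_basis_of_perp (ref_point L - xs) Us ->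
  (forall j, in_window cpar ceta L b h (ys j)) ->
  (forall j, frob (alphas j) <= calpha) ->
  let rec := alpha_rec (scaled_array a D) k L ys alphas xs Us in
  (forall (i : 'I_N) (x : R), 0 <= x -> cross_bound k L a ys (fun j => j != i) (ys i) x ->
     frob (rec (ys i) - alpha_proj Us (alphas i)) <=
       C * (x + a / L + a ^+ 2 * Theta k L a / L ^+ 2 + Theta k L b)) /\
  (forall (y : 'cV[R]_3) (x : R), in_window cpar ceta L b h y ->
     0 <= x -> cross_bound k L a ys predT y x ->
     frob (rec y) <= C * (x + a ^+ 2 * Theta k L a / L ^+ 2 + Theta k L b))].
Proof.
move=> hD M0; have [c0 c01 hc0] := scaled_array_bounds hD.
have [c [c1 c0c cparc cetac]] : exists c : R, [/\ 1 <= c, c0 <= c, cpar <= c & ceta <= c].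
  exists (c0 + `|cpar| + `|ceta|).
  have := ler_norm cpar; have := ler_norm ceta.
  by have := normr_ge0 cpar; have := normr_ge0 ceta; split; lra.
have cp : 0 < c by exact: lt_le_trans c1.
have [C1 hC1] := pair_image_near calpha c1 M0.
have [C2 hC2] := pair_image_far calpha hD c1 M0.
have [C3 hC3] := pair_image_close calpha c1 M0.
have cM0 : 0 <= c * M by rewrite mulr_ge0// ltW.
(* With eps = 1 / K, one threshold meets all smallness demands: eps <= 1, 6 (2 c + c M) eps <= 1 and
   c M eps^2 <= 1 / 2. *)
pose K := 6 * (2 * c + c * M) + 2 * (c * M) + 1.
have K1 : 1 <= K by rewrite /K; lra.
have K0 : 0 < K by lra.
(* N |C2| accounts for the distant dipoles, 1 + 4 c for absorbing a / L in (ii), |C1| for the imaged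
   dipole in (i), and 1 for positivity. The outer 36 is the cost of multiplying by [U_par] and
   [Us]. *)
pose E := N%:R * `|C2| * (1 + 4 * c) + `|C1| + 1.
have E2 : 0 <= N%:R * `|C2| * (1 + 4 * c).
  by rewrite mulr_ge0 ?mulr_ge0//; lra.
have E1 : N%:R * `|C2| <= N%:R * `|C2| * (1 + 4 * c).
  by rewrite ler_peMr ?mulr_ge0//; lra.
exists (36 * E), K^-1; split.
- by rewrite mulr_gt0// /E ltr_wpDl// addr_ge0.
- by rewrite invr_gt0.
move=> k L a b h hreg xs Us ys alphas xsL hUs hys hal rec.
have [k0 L0 a0 b0 h0 _ _ _ _ _] := hreg.
have Kv0 : 0 < K^-1 by rewrite invr_gt0.
have eps1 : K^-1 <= 1 by rewrite invf_le1.
have keps : 6 * (2 * c + c * M) * K^-1 <= 1.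
  by rewrite ler_pdivrMr// mul1r /K; lra.
have ceps : c * M * K^-1 ^+ 2 <= 1 / 2.
  have h1 : c * M * K^-1 <= 1 / 2 by rewrite ler_pdivrMr// /K; lra.
  apply: le_trans h1; rewrite expr2 ler_wpM2l// ler_piMr// ltW//.
have UU : Us^T *m Us = 1%:M by case: hUs.
have near j := in_window_near_ref b0 h0 cparc cetac (hys j).
have mA := scaled_array_measurable hD a0.
have bA : bounded_array c a (scaled_array a D).
  have [hA fA m1 m2] := hc0 a a0.
  have cca : c0 * a <= c * a by rewrite ler_pM2r.
  split => //.
  - by move=> p /hA[p1 p2]; split; exact: le_trans cca.
  - apply: le_trans m1; rewrite ler_pM2l ?exprn_gt0// lef_pV2 ?posrE//.
    exact: lt_le_trans c01.
  - by rewrite (le_trans m2)// ler_pM2r ?exprn_gt0.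
have recE y : near_ref c L b h y -> rec y = adj_mx (cplx_mx (U_par R)) *m
    (\sum_(n < N) pair_image (scaled_array a D) k L xs y (ys n) (alphas n)) *m cplx_mx Us.
  move=> hy; apply: alpha_rec_sum => //; first by case: bA.
  by move=> n; have [] := hC3 _ _ _ _ _ _ hreg eps1 keps _ _ _ _ xsL hy (near n)
    (hal n) _ mA bA.
have far y n x : near_ref c L b h y ->
    0 < enorm (cross_range (ys n) - cross_range y) ->
    L / (a * k * enorm (cross_range (ys n) - cross_range y)) <= x ->
    mxn (pair_image (scaled_array a D) k L xs y (ys n) (alphas n)) <=
    `|C2| * (a / L + a ^+ 2 * Theta k L a / L ^+ 2 + Theta k L b + x).
  move=> hy w0 wx.
  have yn : cross_range y <> cross_range (ys n).
    move=> e; move: w0; rewrite e subrr /enorm big1 ?sqrtr0 ?ltxx// => i _.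
    by rewrite mxE expr0n.
  apply: le_trans (hC2 _ _ _ _ _ _ hreg eps1 keps ceps bA _ _ _ _ xsL hy (near n) (hal n) yn) _.
  have q0 := ltW (regime_q hreg).
  have tau0 : 0 <= a ^+ 2 * Theta k L a / L ^+ 2.
    by apply: le_trans (regime_q2_tau hreg); exact: sqr_ge0.
  have beta0 : 0 <= Theta k L b by rewrite /Theta divr_ge0 ?mulr_ge0 ?sqr_ge0 ?ltW.
  have cr0 : 0 <= L / (a * k * enorm (cross_range (ys n) - cross_range y)).
    by rewrite divr_ge0 ?mulr_ge0 ?enorm_ge0 ?ltW.
  apply: (@le_trans _ _ (`|C2| * (a / L + a ^+ 2 * Theta k L a / L ^+ 2 + Theta k L b +
    L / (a * k * enorm (cross_range (ys n) - cross_range y))))).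
    by rewrite ler_wpM2r ?ler_norm// !addr_ge0.
  by rewrite ler_wpM2l// lerD2l.
set q := a / L in far *; set tau := a ^+ 2 * _ / _ in far *; set beta := Theta k L b in far *.
have q0 : 0 <= q by exact: ltW (regime_q hreg).
have tau0 : 0 <= tau by apply: le_trans (regime_q2_tau hreg); exact: sqr_ge0.
have beta0 : 0 <= beta by rewrite /beta /Theta divr_ge0 ?mulr_ge0 ?sqr_ge0 ?ltW.
split.
- move=> i x x0 hx; rewrite (recE _ (near i)) -(alpha_proj_limit (alphas i) hUs).
  rewrite -mulmxBl -mulmxBr (le_trans (frob_sandwich _ UU))// -[leRHS]mulrA ler_pM2l//.
  rewrite (bigD1 i)//= addrAC (le_trans (mxnD _ _))//.
  have h1 := hC1 _ _ _ _ _ _ hreg eps1 keps _ _ _ xsL (near i) (hal i) _ mA bA.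
  have s0 : 0 <= q + tau + beta + x by rewrite !addr_ge0.
  have h2 : mxn (\sum_(n < N | n != i) pair_image (scaled_array a D) k L xs (ys i) (ys n) (alphas n))
      <= N%:R * (`|C2| * (q + tau + beta + x)).
    rewrite (le_trans (mxn_sum _ _ _))// sum_le_const ?mulr_ge0// => n ni.
    by have [w0 wx] := hx n ni; exact: far.
  have h3 : C1 * q <= `|C1| * (q + tau + beta + x).
    rewrite (@le_trans _ _ (`|C1| * q))// ?ler_wpM2r ?ler_norm// ler_wpM2l//; lra.
  have h4 : N%:R * (`|C2| * (q + tau + beta + x)) <=
      N%:R * `|C2| * (1 + 4 * c) * (q + tau + beta + x).
    by rewrite mulrA ler_wpM2r.
  rewrite (le_trans (lerD (le_trans h1 h3) (le_trans h2 h4)))//.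
  rewrite (_ : x + q + tau + beta = q + tau + beta + x); last by ring.
  by rewrite /E !mulrDl; lra.
- move=> y x wy x0 hx; have hy := in_window_near_ref b0 h0 cparc cetac wy.
  rewrite (recE _ hy) (le_trans (frob_sandwich _ UU))// -[leRHS]mulrA ler_pM2l//.
  have s0 : 0 <= x + tau + beta by rewrite !addr_ge0.
  apply: (@le_trans _ _ (N%:R * (`|C2| * (1 + 4 * c) * (x + tau + beta)))).
    rewrite (le_trans (mxn_sum _ _ _))// sum_le_const// => [|n _].
      by rewrite !mulr_ge0//; lra.
    have [w0 wx] := hx n isT; rewrite (le_trans (far y n x hy w0 wx))//.
    rewrite -[leRHS]mulrA ler_wpM2l//.
    have q4 : q <= 4 * c * x.
      rewrite (le_trans (aspect_le_cross hreg cp hy (near n) w0))// ler_wpM2l//.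
      by rewrite mulr_ge0// ltW.
    have t4 : 0 <= 4 * c * (tau + beta) by rewrite mulr_ge0 ?addr_ge0// mulr_ge0// ltW.
    rewrite mulrDl mul1r; lra.
  by rewrite !mulrA ler_wpM2r// /E; have := normr_ge0 C1; lra.
Qed.

(** A ratio tending to 0 is eventually at most 1, and a / L eventually at most [eps]. The absolute
    value of [M] supplies a nonnegative constant. *)
Lemma fraunhofer_regime (R : realType) (T : Type) (F : set_system T) (FF : Filter F)
    (k L a b h : T -> R) (M eps : R) : 0 < eps -> fraunhofer F k L a b h M ->
  \forall t \near F, regime (k t) (L t) (a t) (b t) (h t) `|M| eps.
Proof.
move=> eps0 [pos _ la _ _ lTb lTa lTup lkh].
have near_a := @cvgr_le R T F FF _ _ la eps eps0.
have near_Tb := @cvgr_le R T F FF _ _ lTb 1 ltr01.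
have near_Ta := @cvgr_le R T F FF _ _ lTa 1 ltr01.
have near_Tup := @cvgr_le R T F FF _ _ lTup 1 ltr01.
near=> t; have [k0 L0 a0 b0 h0] := pos t; split => //.
- by apply: le_trans (ler_norm M); near: t.
- by near: t.
- have : 1 / Theta (k t) (L t) (a t) <= 1 by near: t.
  by rewrite ler_pdivrMr ?mul1r// /Theta divr_gt0// mulr_gt0// exprn_gt0.
- by rewrite -[leLHS]divr1; near: t.
- have : Theta (k t) (L t) (a t) / (L t ^+ 2 / a t ^+ 2) <= 1 by near: t.
  by rewrite invf_div mulrCA mulrA.
Unshelve. all: by end_near. Qed.

Theorem theorem2 (R : realType) (shape : set (R * R)) (N : nat)
    (cpar ceta calpha M : R) (hshape : planar_shape shape) :
  exists2 C : R, 0 < C &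
  forall (T : Type) (F : set_system T) (FF : Filter F) (k L a b h : T -> R),
  fraunhofer F k L a b h M ->
  \forall t \near F,
  forall (xs : 'cV[R]_3) (Us : 'M[R]_(3, 2))
         (ys : 'I_N -> 'cV[R]_3) (alphas : 'I_N -> 'M[R[i]%C]_3),
  enorm (xs - ref_point (L t)) = L t ->
  orthonormal_basis_of_perp (ref_point (L t) - xs) Us ->
  (forall j, in_window cpar ceta (L t) (b t) (h t) (ys j)) ->
  (forall j, (alphas j)^T = alphas j) ->
  (forall j, frob (alphas j) <= calpha) ->
  let A := scaled_array (a t) shape in
  let rec := alpha_rec A (k t) (L t) ys alphas xs Us in
  (forall i : 'I_N,
     ((frob (rec (ys i) - alpha_proj Us (alphas i)))%:E <=
      C%:E * (cross_term (k t) (L t) (a t)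
                (min_cross_dist ys (fun j => j != i) (ys i))
              + (a t / L t)%:E
              + (a t ^+ 2 * Theta (k t) (L t) (a t) / L t ^+ 2)%:E
              + (Theta (k t) (L t) (b t))%:E))%E) /\
  (forall y : 'cV[R]_3,
     in_window cpar ceta (L t) (b t) (h t) y ->
     (forall j, cross_range y <> cross_range (ys j)) ->
     ((frob (rec y))%:E <=
      C%:E * (cross_term (k t) (L t) (a t)
                (min_cross_dist ys predT y)
              + (a t ^+ 2 * Theta (k t) (L t) (a t) / L t ^+ 2)%:E
              + (Theta (k t) (L t) (b t))%:E))%E).
Proof.
have [C [eps [C0 eps0 hC]]] :=
  alpha_rec_bounds N cpar ceta calpha hshape (normr_ge0 M).
exists C => // T F FF k L a b h hF.
have hreg := fraunhofer_regime FF eps0 hF.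
near=> t; have ht : regime (k t) (L t) (a t) (b t) (h t) `|M| eps by near: t.
move=> xs Us ys alphas xsL hUs hys _ hal; cbv zeta.
have [k0 L0 a0 _ _ _ _ _ _ _] := ht.
have [bound_i bound_y] := hC _ _ _ _ _ ht xs Us ys alphas xsL hUs hys hal.
(* When the minimum vanishes, the right-hand side is +oo and the bound is immediate. *)
have unbounded (u : R) : (C%:E * (+oo + u%:E))%E = +oo%E.
  by rewrite addye// gt0_muley// lte_fin.
split=> [i|y hy _].
- have [->|[x x0 [-> hx]]] :=
    cross_termP ys (fun j => j != i) (ys i) k0 L0 a0.
    by rewrite -!addeA -!EFinD unbounded leey.
  by rewrite -!EFinD -EFinM lee_fin; exact: bound_i.
- have [->|[x x0 [-> hx]]] := cross_termP ys predT y k0 L0 a0.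
    by rewrite -!addeA -!EFinD unbounded leey.
  by rewrite -!EFinD -EFinM lee_fin; exact: bound_y.
Unshelve. all: by end_near. Qed.
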